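(* Let $(M,F,\mathfrak{m})$ be a Finsler metric measure manifold with $\mathfrak{m}(M)=1$. Then $(M,F,\mathfrak{m})$ has exponential concentration, i.e. there are positive constants $C$ and $c$ such that $\alpha_{(M,F,\mathfrak{m})}(r)\le Ce^{-cr}$ for every $r>0$, if and only if there are positive constants $C'$ and $c'$ such that for every 1-Lipschitz function $f$ on $(M,F,\mathfrak{m})$ and every $r>0$, $$\mathfrak{m}\left(\left\{x\in M\;\middle|\;\left|f(x)-\int_M f\,d\mathfrak{m}\right|\ge r\right\}\right)\le C'e^{-c'r}.$$ Here $C'=C'(C)$ and $c'=c'(c)$ are constants ($C'$ depending on $C$, and $c'$ depending on $c$).
   Context: A Finsler metric on a smooth manifold $M$ is a function $F:TM\to[0,\infty)$ that is $C^\infty$ on $TM\setminus\{0\}$, satisfies $F(x,\lambda y)=\lambda F(x,y)$ for $\lambda>0$, and for which $g_{ij}(x,y)=\frac12 (F^2)_{y^iy^j}(x,y)$ is positive definite for every nonzero $y\in T_xM$ ($F$ need not be reversible). A Finsler metric measure manifold $(M,F,\mathfrak{m})$ is a Finsler manifold $(M,F)$ with a positive smooth measure $\mathfrak{m}$. $M$ is connected, and the (possibly asymmetric) distance $d_F:M\times M\to[0,\infty)$ is $d_F(x_1,x_2)=\inf_\gamma\int_0^1F(\gamma(t),\dot\gamma(t))\,dt$ over $C^1$ curves $\gamma:[0,1]\to M$ from $x_1$ to $x_2$. For $A\subset M$, $r>0$: $B^{+}(A,r)=\{x\mid\inf_{z\in A}d_F(z,x)<r\}$ and $B^{-}(A,r)=\{x\mid\inf_{z\in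 A}d_F(x,z)<r\}$. The concentration function is $$\alpha_{(M,F,\mathfrak{m})}(r)=\sup\left\{1-\min\{\mathfrak{m}(B^{+}(A,r)),\mathfrak{m}(B^{-}(A,r))\}\;\middle|\;A\subset M\text{ Borel},\ \mathfrak{m}(A)\ge\tfrac12\right\},\quad r>0.$$ A function $f:M\to\mathbb{R}$ is 1-Lipschitz if $f(z)-f(x)\le d_F(x,z)$ for all $x,z\in M$. *)

(* Defs.v *)
From HB Require Import structures.
From mathcomp Require Import all_boot all_order all_algebra.
From mathcomp Require Import all_classical all_reals all_analysis.

Set Implicit Arguments.
Unset Strict Implicit.
Unset Printing Implicit Defensive.

Import Order.TTheory GRing.Theory Num.Theory.
Import numFieldNormedType.Exports.

Local Open Scope classical_set_scope.
Local Open Scope ring_scope.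

(* For open [U] and finite-dimensional [V], existence and continuity of all
   iterated directional derivatives up to order [k] is the usual C^k. *)
Fixpoint Ck_on (R : realType) (V W : normedModType R) (k : nat)
    (U : set V) (f : V -> W) : Prop :=
  (forall x, U x -> {for x, continuous f}) /\
  match k with
  | 0 => True
  | k'.+1 => forall v : V,
      (forall x, U x -> derivable f x v) /\ Ck_on k' U ('D_v f)
  end.

Definition smooth_on (R : realType) (V W : normedModType R)
    (U : set V) (f : V -> W) : Prop := forall k, Ck_on k U f.

(* The atlas is not required to be maximal. [chart i] and [chart_inv i] are
   total functions, meaningful on [dom i] and [chart i @` dom i] only.
   [chart_at x] is a preferred chart around [x]; it need not depend on [x] in
   any regular way. The distinguished point of [carrier] plays no role beyond
   nonemptiness. *)
Record smooth_manifold (R : realType) (n : nat) := SmoothManifold {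
  carrier :> ptopologicalType ;
  carrier_hausdorff : hausdorff_space carrier ;
  carrier_second_countable : @second_countable carrier ;
  chart_index : Type ;
  dom : chart_index -> set carrier ;
  chart : chart_index -> carrier -> 'rV[R]_n ;
  chart_inv : chart_index -> 'rV[R]_n -> carrier ;
  chart_at : carrier -> chart_index ;
  chart_at_dom : forall x, dom (chart_at x) x ;
  dom_open : forall i, open (dom i) ;
  cod_open : forall i, open (chart i @` dom i) ;
  chartK : forall i x, dom i x -> chart_inv i (chart i x) = x ;
  chart_continuous : forall i x, dom i x -> {for x, continuous (chart i)} ;
  chart_inv_continuous : forall i u, (chart i @` dom i) u ->
    {for u, continuous (chart_inv i)} ;
  transition_smooth : forall i j,
    smooth_on (chart i @` (dom i `&` dom j)) (chart j \o chart_inv i)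
}.

Arguments dom {R n s} i.
Arguments chart {R n s} i x.
Arguments chart_inv {R n s} i u.
Arguments chart_at {R n s} x.

Section Tangent.
Variables (R : realType) (n : nat) (M : smooth_manifold R n).

(* A tangent vector at [x] is encoded by its components in the chart
   [chart_at x], so that TM is [M * 'rV[R]_n]. [tangent_coord i u v] is the
   encoding of the vector at [chart_inv i u] whose components in the chart [i]
   are [v]: they are transformed by the differential of the transition map. *)
Definition tangent_coord (i : chart_index M) (u v : 'rV[R]_n) : 'rV[R]_n :=
  'D_v (chart (chart_at (chart_inv i u)) \o chart_inv i) u.

Definition in_chart (F : M -> 'rV[R]_n -> R) (i : chart_index M)
    (p : 'rV[R]_n * 'rV[R]_n) : R :=
  F (chart_inv i p.1) (tangent_coord i p.1 p.2).

Definition fundamental_tensor (F : M -> 'rV[R]_n -> R) (x : M)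
    (y : 'rV[R]_n) : 'M[R]_n :=
  \matrix_(i, j) (2^-1 *
    'D_(delta_mx 0 j) ('D_(delta_mx 0 i) (fun v : 'rV[R]_n => F x v ^+ 2)) y).

(* C^1 on the compact interval [0, 1] means: C^1 on an open set containing it.
   Only the restriction of [gamma] to [0, 1] matters. *)
Definition C1_curve (gamma : R -> M) : Prop :=
  exists U : set R, [/\ open U, `[0, 1] `<=` U,
    (forall t, U t -> {for t, continuous gamma}) &
    forall i : chart_index M,
      Ck_on 1 (U `&` gamma @^-1` dom i) (chart i \o gamma)].

Definition velocity (gamma : R -> M) (t : R) : 'rV[R]_n :=
  derive1 (chart (chart_at (gamma t)) \o gamma) t.

End Tangent.

Definition posdefmx (R : realType) (n : nat) (A : 'M[R]_n) : Prop :=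
  forall w : 'rV[R]_n, w != 0 -> 0 < (w *m A *m w^T) 0 0.

Record finsler_manifold (R : realType) (n : nat) := FinslerManifold {
  manifold :> smooth_manifold R n ;
  manifold_connected : connected [set: manifold] ;
  finsler : manifold -> 'rV[R]_n -> R ;
  finsler_ge0 : forall x y, 0 <= finsler x y ;
  finsler_smooth : forall i : chart_index manifold,
    smooth_on [set p : 'rV[R]_n * 'rV[R]_n |
                 (chart i @` dom i) p.1 /\ p.2 != 0]
      (in_chart finsler i) ;
  finsler_homogeneous : forall (x : manifold) (lambda : R) (y : 'rV[R]_n), 0 < lambda ->
    finsler x (lambda *: y) = lambda * finsler x y ;
  finsler_posdef : forall (x : manifold) (y : 'rV[R]_n), y != 0 ->
    posdefmx (fundamental_tensor finsler x y)
}.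

(* By Tonelli, the Lebesgue integral over R^n of a nonnegative Borel function. *)
Fixpoint iterated_integral (R : realType) (n : nat) :
    ('rV[R]_n -> \bar R) -> \bar R :=
  match n with
  | 0 => fun f => f 0
  | n'.+1 => fun f =>
      (\int[@lebesgue_measure R]_t
         @iterated_integral R n'
           (fun u => f (row_mx (const_mx t : 'rV[R]_1) u)))%E
  end.

Definition borel (T : ptopologicalType) := g_sigma_algebraType (@open T).

(* In every chart the measure has a positive smooth density with respect to
   Lebesgue measure. *)
Definition positive_smooth_measure (R : realType) (n : nat)
    (M : smooth_manifold R n) (m : {measure set (borel M) -> \bar R}) : Prop :=
  forall i : chart_index M, exists sigma : 'rV[R]_n -> R,
    [/\ smooth_on (chart i @` dom i) sigma,
        (forall u, (chart i @` dom i) u -> 0 < sigma u) &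
        forall A : set (borel M), measurable A -> A `<=` dom i ->
          m A = iterated_integral
                  (fun u => (\1_(chart i @` A) u * sigma u)%:E)].

Record finsler_mm_manifold (R : realType) (n : nat) := FinslerMMManifold {
  finsler_base :> finsler_manifold R n ;
  vol : {measure set (borel finsler_base) -> \bar R} ;
  vol_smooth : positive_smooth_measure vol
}.

Section Concentration.
Variables (R : realType) (n : nat).

Section Distance.
Variable M : finsler_manifold R n.

Definition curve_length (gamma : R -> M) : R :=
  \int[@lebesgue_measure R]_(t in `[0, 1])
    finsler (gamma t) (velocity gamma t).

(* The set is nonempty because [M] is connected, so this is a genuine inf. *)
Definition dF (x1 x2 : M) : R :=
  inf [set curve_length gamma | gamma in
         [set gamma : R -> M |
            [/\ C1_curve gamma, gamma 0 = x1 & gamma 1 = x2]]].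

(* The infima are taken in [\bar R], so balls around [set0] are empty. *)
Definition fwd_ball (A : set M) (r : R) : set M :=
  [set x | (ereal_inf [set (dF z x)%:E | z in A] < r%:E)%E].

Definition bwd_ball (A : set M) (r : R) : set M :=
  [set x | (ereal_inf [set (dF x z)%:E | z in A] < r%:E)%E].

Definition lipschitz1 (f : M -> R) : Prop :=
  forall x z, f z - f x <= dF x z.

End Distance.

Variable M : finsler_mm_manifold R n.

Definition concentration_fun (r : R) : \bar R :=
  ereal_sup
    [set (1 - mine (vol M (fwd_ball A r)) (vol M (bwd_ball A r)))%E
    | A in [set A : set (borel M) |
              measurable A /\ ((2^-1 : R)%:E <= vol M A)%E]].

Definition exp_concentration (C c : R) : Prop :=
  forall r : R, 0 < r -> (concentration_fun r <= (C * expR (- c * r))%:E)%E.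

(* Integrability is part of the property: the mean has to make sense. *)
Definition exp_deviation (C c : R) : Prop :=
  forall f : borel M -> R, lipschitz1 f ->
    (vol M).-integrable [set: borel M] (EFin \o f) /\
    forall r : R, 0 < r ->
      (vol M [set x | (r <= `|f x - \int[vol M]_y f y|)%R]
         <= (C * expR (- c * r))%:E)%E.

End Concentration.

(* Main.v *)
Require Import Defs.
From HB Require Import structures.
From mathcomp Require Import all_boot all_order all_algebra.
From mathcomp Require Import all_classical all_reals all_analysis.
(* [all_analysis] does not export the measurable structure of [\bar R]. *)
From mathcomp Require Import measurable_realfun.
From mathcomp Require Import ring lra.
Import Order.TTheory GRing.Theory Num.Theory.
Import numFieldNormedType.Exports.
Local Open Scope classical_set_scope.
Local Open Scope ring_scope.

(** From concentration to deviation: if [f] is 1-Lipschitz and [m] is nearly a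
    median of [f], then the forward ball of radius [r] around [{f <= m}] lies in
    [{f < m + r}] and the backward ball around [{f >= m}] lies in
    [{f > m - r}]; hence [|f - m|] has an exponential tail. Integrating the tail
    bounds the distance from [m] to the mean by a constant over [c], and
    replacing [m] by the mean only changes the constant [C].
    Conversely, [x |-> inf_(z in A) d(z, x)] and [x |-> - inf_(z in A) d(x, z)]
    are 1-Lipschitz and vanish on [A]; when [m(A) >= 1/2], the deviation bound
    on [A] itself bounds the mean, and then on the complement of a ball around
    [A] it bounds the concentration function.

    Both directions need that [d_F] satisfies the triangle inequality and is
    small near the diagonal, so that balls are open and Lipschitz functions are
    Borel. As curves are C^1, corners are removed by reparametrizing with
    [3 s^2 - 2 s^3], which makes the speed vanish at the junction. *)

Set Implicit Arguments.
Unset Strict Implicit.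
Unset Printing Implicit Defensive.

(** * Differentiation along curves *)

Section calculus.
Variable R : realType.

Lemma is_derive_line (V W : normedModType R) (f : V -> W) (p v : V) (s : R) :
  derivable f (p + s *: v) v ->
  is_derive s 1 (fun t : R => f (p + t *: v)) ('D_v f (p + s *: v)).
Proof.
have E : (fun h : R => h^-1 *: (f (p + (h *: 1 + s) *: v) - f (p + s *: v))) =
    (fun h : R => h^-1 *: (f (h *: v + (p + s *: v)) - f (p + s *: v))).
  apply/funext => h; congr (_ *: (f _ - _)).
  by rewrite scalerDl [h *: 1]mulr1 addrCA.
by move=> df; split; rewrite /derivable /derive/= /shift/= E.
Qed.

(** Only the restriction [g] of [f] to the line through [x] matters. It is a function of one real
    variable, for which derivability is differentiability, so its derivative is linear in the
    direction. *)
Lemma derivableZdir (V W : normedModType R) (f : V -> W) (x v : V) (a : R) :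
  derivable f x v -> derivable f x (a *: v) /\ 'D_(a *: v) f x = a *: 'D_v f x.
Proof.
move=> df; pose g (t : R) := f (x + t *: v).
have dg : is_derive (0:R) (1:R) g ('D_v f x).
  by have := @is_derive_line _ _ f x v 0; rewrite !scale0r !addr0; apply.
have dg0 : differentiable g (0:R) by apply/derivable1_diffP; case: dg.
have E : (fun h : R => h^-1 *: ((f \o shift x) (h *: (a *: v)) - f x)) =
   (fun h : R => h^-1 *: ((g \o shift (0:R)) (h *: a) - g 0)).
  apply/funext => h; rewrite /g /= addr0 scale0r addr0 scalerA.
  by rewrite [x + _]addrC -scalerA scalerA.
split.
  by rewrite /derivable E; exact: (diff_derivable dg0).
rewrite [LHS]/derive E -/('D_a g 0) deriveE//.
by rewrite -[X in 'd g 0 X]mulr1 linearZ/= -deriveE//; case: dg => _ ->.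
Qed.

Lemma coord_le_norm m (v : 'rV[R]_m) j : `|v 0 j| <= `|v|.
Proof.
rewrite [leRHS]/Num.Def.normr/= mx_normrE.
exact: (le_bigmax _ (fun i => `|v i.1 i.2|) (0, j)).
Qed.

Lemma rV_norm_le m (v : 'rV[R]_m) (c : R) :
  0 <= c -> (forall j, `|v 0 j| <= c) -> `|v| <= c.
Proof.
move=> c0 vc; rewrite [leLHS]/Num.Def.normr/= mx_normrE.
by apply: bigmax_le => // -[i j] _; rewrite ord1 /=.
Qed.

(* Change one coordinate at a time and apply the mean value theorem to each step. *)
Lemma partial_increment_le m (g : 'rV[R]_m -> R) (u h : 'rV[R]_m)
    (a : 'I_m -> R) (e r : R) : `|h| < r ->
  (forall x j, `|x - u| < r -> derivable g x (delta_mx 0 j)) ->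
  (forall x j, `|x - u| < r -> `|'D_(delta_mx 0 j) g x - a j| <= e) ->
  `|g (u + h) - g u - \sum_j h 0 j * a j| <= m%:R * e * `|h|.
Proof.
move=> hr dg ge.
pose T k : 'rV[R]_m := \row_j (if (j < k)%N then h 0 j else 0).
have step k (kn : (k < m)%N) :
    `|g (u + T k.+1) - g (u + T k) - h 0 (Ordinal kn) * a (Ordinal kn)|
       <= e * `|h|.
  set i := Ordinal kn; pose w : 'rV[R]_m := h 0 i *: delta_mx 0 i.
  have TE : T k.+1 = T k + 1 *: w.
    apply/rowP => j; rewrite !mxE eqxx /= mul1r.
    have [->|ji] := eqVneq j i; first by rewrite /= ltnSn ltnn mulr1 add0r.
    rewrite mulr0 addr0 ltnS leq_eqVlt (_ : (j == k :> nat) = false)//.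
    exact/negbTE.
  (* In the max norm, each coordinate of [T k + s *: w] is at most that of [h] in absolute value. *)
  have near_u (s : R) : 0 <= s <= 1 -> `|(u + T k + s *: w) - u| < r.
    move=> /andP[s0 s1]; apply: le_lt_trans hr.
    rewrite [_ - u]addrC -(addrA u) addKr; apply: rV_norm_le => // j.
    rewrite !mxE eqxx /=; apply: le_trans (coord_le_norm h j).
    have [->|ji] := eqVneq j i.
      rewrite /= ltnn add0r mulr1 normrM ger0_norm//.
      by rewrite ler_piMl.
    by rewrite !mulr0 addr0; case: ifP; rewrite ?normr0.
  (* Subtracting the linear term makes the derivative a multiple of the error that [e] bounds. *)
  pose f (s : R) : R := g (u + T k + s *: w) - s * (h 0 i * a i).
  pose df (s : R) : R := h 0 i * ('D_(delta_mx 0 i) g (u + T k + s *: w) - a i).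
  have dfE (s : R) : 0 <= s <= 1 -> is_derive s (1 : R) f (df s).
    move=> /near_u /(dg _ i) /(derivableZdir (h 0 i))[d1 d2].
    have H1 := is_derive_line d1; rewrite -/w d2 in H1.
    have H2 : is_derive s (1 : R) (fun s : R => s * (h 0 i * a i)) (h 0 i * a i).
      have -> : (fun s : R => s * (h 0 i * a i)) =
         (fun s : R => 0 + s *: (h 0 i * a i : R^o)) by apply/funext => x; rewrite add0r.
      have := @is_derive_line _ _ (id : R^o -> R^o) 0 (h 0 i * a i) s
         (@derivable_id _ _ _ _).
      by rewrite derive_id.
    by rewrite /df mulrBr; exact: is_deriveB.
  have [||c c01] := @MVT_segment R f df 0 1 ler01.
  - by move=> x; rewrite in_itv/= => /andP[x0 x1]; apply: dfE; rewrite !ltW.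
  - apply: derivable_within_continuous => x; rewrite in_itv/= => /dfE.
    by case.
  rewrite subr0 mulr1 {1 2}/f scale0r addr0 mul0r subr0 mul1r -[_ + 1 *: w]addrA -TE.
  move=> E; rewrite addrAC in E; rewrite E /df normrM mulrC.
  apply: ler_pM => //; last exact: coord_le_norm.
  by apply: ge; apply: near_u; move: c01; rewrite in_itv.
have claim k : (k <= m)%N -> `|g (u + T k) - g u -
    \sum_(j < m | (j < k)%N) h 0 j * a j| <= k%:R * e * `|h|.
  elim: k => [_|k IH km].
    rewrite big_pred0// (_ : T 0 = 0) ?addr0 ?subrr ?subr0 ?normr0 ?mul0r//.
    by apply/rowP => j; rewrite !mxE.
  have -> : \sum_(j < m | (j < k.+1)%N) h 0 j * a j =
      h 0 (Ordinal km) * a (Ordinal km) + \sum_(j < m | (j < k)%N) h 0 j * a j.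
    rewrite (bigD1 (Ordinal km))//=; congr (_ + _); apply: eq_bigl => j.
    by rewrite ltnS ltn_neqAle andbC.
  have := IH (ltnW km); have := step k km.
  set X := h 0 _ * _; set Y := \sum_(_ < _ | _) _ => A1 A2.
  rewrite (_ : _ - (X + Y) = (g (u + T k.+1) - g (u + T k) - X) +
     (g (u + T k) - g u - Y)); last by ring.
  apply: le_trans (ler_normD _ _) _.
  by apply: le_trans (lerD A1 A2) _; rewrite -[k.+1%:R]natr1; lra.
have := claim m (leqnn m).
rewrite (_ : T m = h); last by apply/rowP => j; rewrite !mxE ltn_ord.
by under eq_bigl do rewrite ltn_ord.
Qed.

Lemma differentiable_approx (V W : normedModType R) (f : V -> W)
  (L : {linear V -> W}) (x : V) : continuous L ->
  (forall e, 0 < e -> \forall h \near 0, `|f (h + x) - (f x + L h)| <= e * `|h|) ->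
  differentiable f x.
Proof.
move=> cL fL; suff H : f \o shift x = cst (f x) + L +o_ 0 id.
  have E : 'd f x = L :> (_ -> _) by exact: diff_unique.
  by apply/diff_locallyP; rewrite E.
by apply/eqaddoP => e e0; exact: fL.
Qed.

(** Continuous partial derivatives give differentiability, with the Jacobian [J] as differential:
    [partial_increment_le] applies to each component of [f]. [Ck_on] only provides directional
    derivatives, which do not suffice for the chain rule. *)
Lemma Ck1_open_differentiable m n (S : set 'rV[R]_m) (f : 'rV[R]_m -> 'rV[R]_n)
  (u : 'rV[R]_m) : open S -> S u -> Ck_on 1 S f -> differentiable f u.
Proof.
move=> oS Su [_ dS].
pose J : 'M[R]_(m, n) := \matrix_(j, k) 'D_(delta_mx 0 j) f u 0 k.
pose L : {linear 'rV[R]_m -> 'rV[R]_n} := mulmxr J.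
have cL : continuous L.
  apply/bounded_linear_continuous/linear_boundedP.
  suff H v : `|L v| <= (\sum_j \sum_k `|J j k|) * `|v|.
    by near=> K => v; apply: le_trans (H v) _; rewrite ler_wpM2r//; near: K; exact: nbhs_pinfty_ge.
  apply: rV_norm_le => [|k].
    by rewrite mulr_ge0// sumr_ge0// => j _; rewrite sumr_ge0.
  rewrite /L/= mxE mulr_suml; apply: le_trans (ler_norm_sum _ _ _) _.
  apply: ler_sum => j _; rewrite normrM mulrC; apply: ler_pM => //.
    by rewrite (bigD1 k)//= lerDl sumr_ge0.
  exact: coord_le_norm.
apply: (differentiable_approx cL) => _/posnumP[eps].
(* The increment bound carries a factor [m]; dividing by [m.+1] also covers [m = 0]. *)
pose e := eps%:num / m.+1%:R.
have e0 : 0 < e by rewrite divr_gt0.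
have nS : \forall x \near u, S x /\
    forall j, `|'D_(delta_mx 0 j) f u - 'D_(delta_mx 0 j) f x| <= e.
  apply: filterI; first exact: open_nbhs_nbhs.
  apply: (@filter_forall _ 'I_m (fun j x =>
    `|'D_(delta_mx 0 j) f u - 'D_(delta_mx 0 j) f x| <= e) (nbhs u) (nbhs_filter u)) => j.
  have [_ [+ _]] := dS (delta_mx 0 j); move=> /(_ _ Su)/cvgrPdist_le; exact.
have [r /= r0 rS] := (nbhs_normP u _).1 nS.
have n0 : \forall h \near (0 : 'rV[R]_m), `|h| < r by exact: nbhs0_lt.
apply: filterS n0 => h hr.
apply: rV_norm_le => [|k]; first by rewrite mulr_ge0.
have := @partial_increment_le m (fun x => f x 0 k) u h (J ^~ k) e r hr.
move=> H; rewrite [h + u]addrC !mxE opprD addrA.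
have rSx x : `|x - u| < r -> S x /\
    forall j, `|'D_(delta_mx 0 j) f u - 'D_(delta_mx 0 j) f x| <= e.
  by move=> xr; apply: rS; rewrite /= distrC.
apply: le_trans (H _ _) _.
- move=> x j /rSx[Sx _]; have [/(_ _ Sx) + _] := dS (delta_mx 0 j).
  by move=> /derivable_mxP; exact.
- move=> x j /rSx[Sx /(_ j) xe]; have [/(_ _ Sx) + _] := dS (delta_mx 0 j).
  move=> /derive_mx E; apply: le_trans xe; rewrite distrC.
  have -> : 'D_(delta_mx 0 j) (fun x => f x 0 k) x = 'D_(delta_mx 0 j) f x 0 k.
    by rewrite E mxE.
  by have := coord_le_norm ('D_(delta_mx 0 j) f u - 'D_(delta_mx 0 j) f x) k;
     rewrite !mxE.
- rewrite ler_wpM2r// /e mulrA ler_pdivrMr// mulrC ler_wpM2l// ler_nat.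
  exact: leqnSn.
Unshelve. all: by end_near. Qed.

Lemma is_derive_comp_diff (V W : normedModType R) (f : V -> W) (c : R -> V)
  (t : R) : differentiable f (c t) -> derivable c t 1 ->
  is_derive t 1 (f \o c) ('D_('D_1 c t) f (c t)).
Proof.
move=> df /derivable1_diffP dc.
have dfc := differentiable_comp dc df.
apply: DeriveDef; first exact: diff_derivable.
by rewrite deriveE// diff_comp//= -deriveE// -deriveE.
Qed.

Lemma is_derive_reparam (V : normedModType R) (c : R -> V) (p : R -> R) (t : R) :
  derivable c (p t) 1 -> derivable p t 1 ->
  is_derive t 1 (c \o p) ('D_1 p t *: 'D_1 c (p t)).
Proof.
move=> dc dp.
have := is_derive_comp_diff (iffLR (derivable1_diffP _ _) dc) dp.
by rewrite -(derivableZdir ('D_1 p t) dc).2 [_ *: 1]mulr1.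
Qed.

Definition glue (T : Type) (a : R) (f g : R -> T) (t : R) : T :=
  if t <= a then f t else g t.

Lemma glue_near_lt (T : Type) (a : R) (f g : R -> T) (t : R) : t < a ->
  \near t, glue a f g t = f t.
Proof.
by move=> ta; near=> s; rewrite /glue ifT//; near: s; apply: filterS (lt_nbhsl ta) => y; exact: ltW.
Unshelve. all: by end_near. Qed.

Lemma glue_near_gt (T : Type) (a : R) (f g : R -> T) (t : R) : a < t ->
  \near t, glue a f g t = g t.
Proof.
move=> ta; near=> s; rewrite /glue ifF//; apply/negbTE; rewrite -ltNge.
by near: s; exact: lt_nbhsr.
Unshelve. all: by end_near. Qed.

Lemma continuous_glue (T : topologicalType) (a : R) (f g : R -> T) :
  f a = g a -> {for a, continuous f} -> {for a, continuous g} ->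
  {for a, continuous (glue a f g)}.
Proof.
move=> fg cf cg A; rewrite /glue lexx => nA.
have nf : \forall s \near a, A (f s) by exact: cf.
have ng : \forall s \near a, A (g s) by apply: cg; rewrite -fg.
suff : \forall s \near a, A (glue a f g s) by [].
near=> s.
have fs : A (f s) by near: s.
have gs : A (g s) by near: s.
by rewrite /glue /=; case: ifP.
Unshelve. all: by end_near. Qed.

(** Every difference quotient of the glued map at [a] is one of [f] or one of [g], and both converge
    to [d]. *)
Lemma is_derive_glue (V : normedModType R) (a : R) (f g : R -> V) (d : V) :
  f a = g a -> is_derive a 1 f d -> is_derive a 1 g d ->
  is_derive a 1 (glue a f g) d.
Proof.
move=> fg [df <-] [dg dE].
suff H : h^-1 *: ((glue a f g \o shift a) (h *: 1) - glue a f g a) @[h --> 0^'] -->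
    'D_1 f a.
  by apply: DeriveDef; [apply/cvg_ex; eexists; exact: H | exact: cvg_lim].
apply/cvgrPdist_le => e e0.
have /cvgrPdist_le /(_ e e0) Hf : h^-1 *: ((f \o shift a) (h *: 1) - f a) @[h --> 0^'] --> 'D_1 f a by exact: df.
have /cvgrPdist_le /(_ e e0) Hg : h^-1 *: ((g \o shift a) (h *: 1) - g a) @[h --> 0^'] --> 'D_1 f a by rewrite -dE; exact: dg.
near=> h; rewrite /glue /= lexx; case: ifP => _; first by near: h.
by rewrite fg; near: h.
Unshelve. all: by end_near. Qed.

End calculus.

(** * Curves of class C^1 and their speed *)

Section curves.
Variables (R : realType) (n : nat).

Lemma continuous_at_near_eq (T U : topologicalType) (f g : T -> U) (t : T) :
  {for t, continuous f} -> (\near t, f t = g t) -> {for t, continuous g}.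
Proof.
move=> cf fg; rewrite /prop_for /continuous_at -(nbhs_singleton fg).
move=> A nA; have := cf A nA; move: fg; apply: filterS2 => s; rewrite /= => ->; exact.
Qed.

Lemma open_setI_preimage (T U : topologicalType) (A : set T) (f : T -> U) (B : set U) :
  open A -> (forall x, A x -> {for x, continuous f}) -> open B ->
  open (A `&` f @^-1` B).
Proof.
move=> oA cf oB; rewrite openE => x [Ax Bx]; apply: filterI.
  exact: open_nbhs_nbhs.
by apply: (cf x Ax); exact: open_nbhs_nbhs.
Qed.

Section manifold.
Variable M : smooth_manifold R n.
Implicit Types (g : R -> M) (t : R) (i j : chart_index M).

(** A pointwise form of C^1 regularity, so that a glued curve can be examined separately at the
    junction and away from it. *)
Definition C1_at g t : Prop :=
  {for t, continuous g} /\ forall i, dom i (g t) ->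
    derivable (chart i \o g) t 1 /\ {for t, continuous ('D_1 (chart i \o g))}.

(** The derivatives along all [v] in [Ck_on 1] are multiples of the one along 1. *)
Lemma C1_curveP g : C1_curve g <->
  exists U : set R, [/\ open U, `[0, 1] `<=` U & forall t, U t -> C1_at g t].
Proof.
split=> -[U].
  move=> [oU U01 cg cU]; exists U; split=> // t Ut; split; first exact: cg.
  move=> i it; have [_ /(_ 1) [d1 [d2 _]]] := cU i.
  by split; [apply: d1 | apply: d2].
move=> [oU U01 cU]; exists U.
have cg t : U t -> {for t, continuous g} by move=> /cU[].
split=> // i.
have oV : open (U `&` g @^-1` dom i) by apply: open_setI_preimage => //; exact: dom_open.
split.
  move=> t [Ut it]; have [_ /(_ i it)[+ _]] := cU t Ut.
  by move=> /derivable1_diffP /differentiable_continuous.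
move=> v; have dv t : (U `&` g @^-1` dom i) t ->
    derivable (chart i \o g) t v /\ 'D_v (chart i \o g) t = v *: 'D_1 (chart i \o g) t.
  move=> [Ut it]; have [_ /(_ i it)[+ _]] := cU t Ut.
  by move=> /(derivableZdir v); rewrite [v *: 1]mulr1.
split=> [t /dv[]//|]; split=> // t Vt.
have [_ /(_ i Vt.2)[_ cD]] := cU t Vt.1.
apply: (@continuous_at_near_eq _ _ (fun t => v *: 'D_1 (chart i \o g) t)).
  by apply: continuousZr.
by apply: filterS (open_nbhs_nbhs (conj oV Vt)) => s /dv[_ ->].
Qed.

Lemma open_overlap i j : open (chart i @` (dom i `&` dom j)).
Proof.
rewrite (_ : _ @` _ = chart i @` dom i `&` chart_inv i @^-1` dom j).
  apply: open_setI_preimage; [exact: cod_open | | exact: dom_open].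
  by move=> u; exact: chart_inv_continuous.
apply/seteqP; split=> [_ [x [ix jx] <-]|_ [[x ix <-]]] /=.
  by split; [exists x | rewrite /= chartK].
by rewrite chartK// => jx; exists x.
Qed.

Lemma transition_C1 i j : Ck_on 1 (chart i @` (dom i `&` dom j)) (chart j \o chart_inv i).
Proof. exact: transition_smooth. Qed.

Lemma transition_differentiable i j x : dom i x -> dom j x ->
  differentiable (chart j \o chart_inv i) (chart i x).
Proof.
move=> ix jx; apply: (Ck1_open_differentiable (@open_overlap i j)).
  by exists x.
exact: transition_C1.
Qed.

(** The preferred chart in [velocity] may jump with [t]. The chain rule through the transition map
    replaces it by one fixed chart, in which continuity can be discussed. *)
Lemma velocity_in_chart g t i : C1_at g t -> dom i (g t) ->
  velocity g t = tangent_coord i (chart i (g t)) ('D_1 (chart i \o g) t).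
Proof.
move=> [cg dg] it; rewrite /velocity /tangent_coord chartK// derive1E.
set j := chart_at (g t).
have jt : dom j (g t) by exact: chart_at_dom.
have [di _] := dg i it.
have := is_derive_comp_diff (transition_differentiable it jt) di.
case=> _ <-; apply: near_eq_derive.
have : \forall s \near t, dom i (g s).
  by apply: cg; apply: open_nbhs_nbhs; split => //; exact: dom_open.
by apply: filterS => s js; rewrite /= chartK.
Qed.

Lemma tangent_coordZ i x (a : R) (w : 'rV[R]_n) : dom i x ->
  tangent_coord i (chart i x) (a *: w) = a *: tangent_coord i (chart i x) w.
Proof.
move=> ix; rewrite /tangent_coord chartK//; apply: (derivableZdir _ _).2.
by apply: diff_derivable; apply: transition_differentiable => //; exact: chart_at_dom.
Qed.

End manifold.

(** * Speed of a curve, and local bounds for the metric in a chart *)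

Section speed.
Variable M : finsler_manifold R n.
Implicit Types (g : R -> M) (t : R) (i j : chart_index M).

Definition speed g t : R := finsler (g t) (velocity g t).

Lemma finsler0 (x : M) : finsler x 0 = 0.
Proof.
have := finsler_homogeneous x 0 (@ltr0n R 2); rewrite scaler0 => H.
by lra.
Qed.

Lemma finslerZ (x : M) (a : R) (w : 'rV[R]_n) : 0 <= a ->
  finsler x (a *: w) = a * finsler x w.
Proof.
rewrite le_eqVlt => /predU1P[<-|a0]; last exact: finsler_homogeneous.
by rewrite scale0r finsler0 mul0r.
Qed.

Lemma speed_in_chart g t i : C1_at g t -> dom i (g t) ->
  speed g t = in_chart (@finsler _ _ M) i (chart i (g t), 'D_1 (chart i \o g) t).
Proof. by move=> ct it; rewrite /speed (velocity_in_chart ct it) /in_chart/= chartK. Qed.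

Lemma in_chartZ i u (a : R) (w : 'rV[R]_n) : 0 <= a -> (chart i @` dom i) u ->
  in_chart (@finsler _ _ M) i (u, a *: w) = a * in_chart (@finsler _ _ M) i (u, w).
Proof. by move=> a0 [x ix <-]; rewrite /in_chart/= tangent_coordZ// chartK// finslerZ. Qed.

Lemma in_chart_continuous i (u w : 'rV[R]_n) : (chart i @` dom i) u -> w != 0 ->
  {for (u, w), continuous (in_chart (@finsler _ _ M) i)}.
Proof. by move=> iu w0; have [+ _] := @finsler_smooth _ _ M i 0; apply. Qed.

(* Compactness of the unit sphere gives the bound for unit vectors, and
   homogeneity extends it; no continuity at zero vectors is available. *)
Lemma in_chart_bound i (u0 : 'rV[R]_n) : (chart i @` dom i) u0 ->
  exists e B : R, [/\ 0 < e, 0 <= B & forall u, `|u - u0| < e ->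
    (chart i @` dom i) u /\
    forall w, in_chart (@finsler _ _ M) i (u, w) <= B * `|w|].
Proof.
move=> iu0; pose F := in_chart (@finsler _ _ M) i.
pose K := [set w : 'rV[R]_n | `|w| = 1].
have cK : compact K.
  apply: bounded_closed_compact.
    by exists 1; split=> // r r1 w /= ->; exact: ltW.
  rewrite (_ : K = (fun w : 'rV[R]_n => `|w|) @^-1` [set 1])//.
  by apply: closed_comp => [? _|]; [exact: norm_continuous|exact: closed_eq].
have /compact_near_coveringP cov := cK.
(* The parameter pairs a base point near [u0] with a bound tending to infinity, so compactness
   yields one neighbourhood and one bound for the whole sphere. *)
have [] := cov _ (filter_prod (nbhs u0) +oo) (fun p w => F (p.1, w) <= p.2) _.
  move=> w Kw; have w0 : w != 0 by rewrite -normr_gt0 Kw.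
  have : \forall p \near (u0, w), F p < F (u0, w) + 1.
    have H : nbhs (F (u0, w)) [set y | y < F (u0, w) + 1].
      by apply: lt_nbhsl; rewrite ltrDl.
    exact: (in_chart_continuous iu0 w0 H).
  move=> [[A B] /= [nA nB] AB].
  exists (B, A `*` [set r | F (u0, w) + 1 < r]) => /=.
    split=> //; exists (A, [set r | F (u0, w) + 1 < r]) => //=; split=> //.
    by exists (F (u0, w) + 1); split => //; exact: num_real.
  move=> [w' [u b]] /= [Bw' [Au Fb]]; apply: ltW; apply: lt_trans Fb.
  exact: (AB (u, w')).
move=> [A C] /= [nA [r [rreal rC]]] AC.
have [e /= e0 eA] := (nbhs_normP u0 _).1 (filterI nA (open_nbhs_nbhs (conj (cod_open (i := i)) iu0))).
(* Every bound above [r] is admissible; [r + 1] is one, and the absolute value makes it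
   nonnegative. *)
exists e, `|r + 1|; split=> // u ue.
have [Au iu] : (A `&` chart i @` dom i) u by apply: eA; rewrite /= distrC.
split=> // w.
have [->|w0] := eqVneq w 0.
  by rewrite -(scale0r 0) in_chartZ// mul0r mulr_ge0.
have wn0 : 0 < `|w| by rewrite normr_gt0.
have -> : w = `|w| *: (`|w|^-1 *: w) by rewrite scalerA divff ?scale1r// gt_eqF.
rewrite in_chartZ// [`| `|w| *: _|]normrZ normrZ normr_id ger0_norm ?invr_ge0//.
rewrite mulVf ?gt_eqF// mulr1 mulrC ler_wpM2r//.
apply: le_trans (ler_norm _); apply: (AC (u, r + 1)) => /=.
  by split=> //; apply: rC; rewrite ltrDl.
by rewrite /K/= normrZ ger0_norm ?invr_ge0// mulVf// gt_eqF.
Qed.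

(** In a chart fixed around [g t], the speed is the metric composed with the position and the
    derivative, both continuous. *)
Lemma continuous_speed g t : (\forall s \near t, C1_at g s) ->
  {for t, continuous (speed g)}.
Proof.
move=> Cg; have [cg /(_ _ (chart_at_dom (g t)))] := nbhs_singleton Cg.
set i := chart_at (g t) => -[dc cD].
have it : dom i (g t) := chart_at_dom (g t).
pose c s := (chart i (g s), 'D_1 (chart i \o g) s).
have cc : {for t, continuous c}.
  have c1 : (chart i \o g) s @[s --> t] --> (chart i \o g) t.
    by move/derivable1_diffP : dc => /differentiable_continuous.
  have c2 : 'D_1 (chart i \o g) s @[s --> t] --> 'D_1 (chart i \o g) t by exact: cD.
  exact: (cvg_pair c1 c2).
have near_i : \forall s \near t, dom i (g s).
  by apply: cg; apply: open_nbhs_nbhs; split => //; exact: dom_open.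
have speedE : \forall s \near t, in_chart (@finsler _ _ M) i (c s) = speed g s.
  by apply: filterS2 Cg near_i => s Cs si; exact/esym/(speed_in_chart Cs si).
have icod : (chart i @` dom i) (chart i (g t)) by exists (g t).
apply: continuous_at_near_eq speedE.
have [D0|D0] := eqVneq ('D_1 (chart i \o g) t) 0; last first.
  by apply: continuous_comp; [exact: cc | exact: in_chart_continuous].
(* The metric is not assumed continuous at the zero vector: squeeze. *)
have [e [B [e0 B0 eB]]] := in_chart_bound icod.
rewrite /prop_for /continuous_at {2}/c D0 -(scale0r 0) in_chartZ// mul0r.
apply/cvgrPdist_le => r r0; near=> s.
have cs : `|chart i (g s) - chart i (g t)| < e.
  near: s; move/derivable1_diffP : dc => /differentiable_continuous.
  by move=> /cvgrPdist_lt /(_ e e0); apply: filterS => s; rewrite distrC.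
have ds : `|'D_1 (chart i \o g) s| <= r / (B + 1).
  near: s; move: cD => /cvgrPdist_le /(_ (r / (B + 1))).
  rewrite D0; have B1 : 0 < B + 1 by rewrite ltr_pwDr.
  by move=> /(_ (divr_gt0 r0 B1)); apply: filterS => s; rewrite sub0r normrN.
rewrite sub0r normrN ger0_norm; last exact: finsler_ge0.
apply: le_trans ((eB _ cs).2 _) _.
have B1 : 0 < B + 1 by rewrite ltr_pwDr.
move: ds; rewrite ler_pdivlMr// mulrC => /(le_trans _); apply.
by rewrite ler_wpM2r// lerDl.
Unshelve. all: by end_near. Qed.

End speed.
End curves.

(** * Reparametrization and gluing *)

Section ramp.
Variable R : realType.
Implicit Types k t : R.

(* [3 s^2 - 2 s^3] at [s = 2 t - k]: it maps [k / 2, (k + 1) / 2] onto [0, 1]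
   with zero derivative at both ends. *)
Definition ramp_poly (k : R) : {poly R} :=
  3 *: (2 *: 'X - k%:P) ^+ 2 - 2 *: (2 *: 'X - k%:P) ^+ 3.

Definition ramp (k t : R) : R := (ramp_poly k).[t].

Lemma rampE k t : ramp k t = 3 * (2 * t - k) ^+ 2 - 2 * (2 * t - k) ^+ 3.
Proof. by rewrite /ramp /ramp_poly !hornerE. Qed.

Lemma derivable_ramp k t : derivable (ramp k) t 1.
Proof. exact: derivable_horner. Qed.

Lemma derive_ramp k t : 'D_1 (ramp k) t = 12 * (2 * t - k) * (1 - (2 * t - k)).
Proof.
have -> : 'D_1 (ramp k) t = (ramp_poly k)^`().[t] by rewrite derivE derive1E.
rewrite /ramp_poly !derivCE !hornerE /=; ring.
Qed.

Lemma continuous_ramp k : continuous (ramp k).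
Proof. exact: continuous_horner. Qed.

Lemma continuous_derive_ramp k : continuous ('D_1 (ramp k)).
Proof.
have -> : 'D_1 (ramp k) = horner (ramp_poly k)^`().
  by rewrite derivE; apply/funext => t; rewrite derive1E.
exact: continuous_horner.
Qed.

Lemma ramp_start k : ramp k (k / 2) = 0.
Proof. by rewrite rampE; field. Qed.

Lemma ramp_end k : ramp k ((k + 1) / 2) = 1.
Proof. by rewrite rampE; field. Qed.

Lemma ramp_mono k : {in `[k / 2, (k + 1) / 2] &, {homo ramp k : x y / x < y}}.
Proof.
move=> x y; rewrite !in_itv/= => /andP[x0 x1] /andP[y0 y1] xy.
rewrite !rampE -subr_gt0.
set a := 2 * x - k; set b := 2 * y - k.
have ab : a < b by rewrite /a /b; lra.
have a0 : 0 <= a by rewrite /a; lra.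
have b1 : b <= 1 by rewrite /b; lra.
(* With [0 <= a < b <= 1], every summand of the second factor is nonnegative and [b * (1 - a)] is
   positive. *)
rewrite (_ : _ - _ = (b - a) * (2 * (b * (1 - b)) + 2 * (a * (1 - a)) +
  (b * (1 - a) + a * (1 - b)))); last by ring.
have ? : 0 < b * (1 - a) by apply: mulr_gt0; lra.
have ? : 0 <= b * (1 - b) by apply: mulr_ge0; lra.
have ? : 0 <= a * (1 - a) by apply: mulr_ge0; lra.
have ? : 0 <= a * (1 - b) by apply: mulr_ge0; lra.
by apply: mulr_gt0; lra.
Qed.

Lemma ramp_itv k t : k / 2 <= t <= (k + 1) / 2 -> ramp k t \in `[0, 1].
Proof.
move=> /andP[kt tk]; rewrite in_itv/= rampE; set b := 2 * t - k.
have b0 : 0 <= b by rewrite /b; lra.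
have b1 : b <= 1 by rewrite /b; lra.
apply/andP; split; rewrite -subr_ge0.
  rewrite (_ : _ - 0 = b ^+ 2 * (3 - 2 * b)); last by ring.
  by apply: mulr_ge0; [exact: sqr_ge0 | lra].
rewrite (_ : 1 - _ = (1 - b) ^+ 2 * (1 + 2 * b)); last by ring.
by apply: mulr_ge0; [exact: sqr_ge0 | lra].
Qed.

Lemma derive_ramp_ge0 k t : k / 2 <= t <= (k + 1) / 2 -> 0 <= 'D_1 (ramp k) t.
Proof. by move=> kt; rewrite derive_ramp; apply: mulr_ge0; lra. Qed.

End ramp.

(** * C^1 regularity and velocity under gluing and reparametrization *)

Section reparametrize.
Variables (R : realType) (n : nat).

Lemma near_eq_derive_continuous (V : normedModType R) (f g : R -> V) (t : R) :
  (\near t, f t = g t) -> {for t, continuous ('D_1 f)} -> {for t, continuous ('D_1 g)}.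
Proof.
move=> fg cf; apply: continuous_at_near_eq cf _.
(* The two functions agree around every point close to [t], hence so do their derivatives. *)
have := nbhs_interior fg; apply: filterS => s fgs; exact: near_eq_derive.
Qed.

Lemma derive_glue (V : normedModType R) (a : R) (f g : R -> V) : f a = g a ->
  derivable f a 1 -> derivable g a 1 -> 'D_1 f a = 'D_1 g a ->
  'D_1 (glue a f g) = glue a ('D_1 f) ('D_1 g).
Proof.
move=> fg df dg D; apply/funext => t.
have [ta|ta|->] := ltgtP t a.
- by rewrite /glue ltW//; apply: near_eq_derive; exact: glue_near_lt.
- by rewrite {2}/glue leNgt ta/=; apply: near_eq_derive; exact: glue_near_gt.
rewrite {2}/glue lexx.
have H1 : is_derive a 1 f ('D_1 f a) by [].
have H2 : is_derive a 1 g ('D_1 f a) by rewrite D.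
by have [_ ->] := is_derive_glue fg H1 H2.
Qed.

Lemma comp_glue (T U : Type) (h : T -> U) (a : R) (f g : R -> T) :
  h \o glue a f g = glue a (h \o f) (h \o g).
Proof. by apply/funext => t; rewrite /glue /=; case: ifP. Qed.

Section manifold.
Variable M : smooth_manifold R n.
Implicit Types (g h : R -> M) (t : R) (p : R -> R).

Lemma C1_at_near_eq g h t : (\near t, g t = h t) -> C1_at g t -> C1_at h t.
Proof.
move=> gh [cg dg]; split; first exact: continuous_at_near_eq gh.
move=> i; rewrite -(nbhs_singleton gh) => it; have [d1 d2] := dg i it.
have gih : \near t, (chart i \o g) t = (chart i \o h) t.
  by apply: filterS gh => s /= ->.
split; first exact: near_eq_derivable d1.
exact: near_eq_derive_continuous d2.
Qed.

Lemma C1_at_glue (a : R) g h : g a = h a -> C1_at g a -> C1_at h a ->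
  (forall i, dom i (g a) -> 'D_1 (chart i \o g) a = 'D_1 (chart i \o h) a) ->
  C1_at (glue a g h) a.
Proof.
move=> gh [cg dg] [ch dh] D; split; first exact: continuous_glue.
move=> i; rewrite {1}/glue lexx => it.
have [d1 d2] := dg i it; have [e1 e2] := dh i ltac:(by rewrite -gh).
have ghi : (chart i \o g) a = (chart i \o h) a by rewrite /= gh.
rewrite comp_glue; split; last first.
  rewrite (derive_glue ghi d1 e1 (D i it)).
  by apply: continuous_glue; [exact: D | exact: d2 | exact: e2].
have H1 := derivableP d1; have H2 := derivableP e1.
by rewrite -(D i it) in H2; have [] := is_derive_glue ghi H1 H2.
Qed.

Lemma C1_at_comp (U : set R) g p t : open U -> (forall s, U s -> C1_at g s) ->
  (forall s, derivable p s 1) -> continuous ('D_1 p) -> U (p t) ->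
  C1_at (g \o p) t.
Proof.
move=> oU gU dp cDp Upt; have [cg dg] := gU _ Upt.
have cp s : {for s, continuous p}.
  by have /derivable1_diffP/differentiable_continuous := dp s.
split; first by apply: continuous_comp; [exact: cp | exact: cg].
move=> i it; have [d1 d2] := dg i it.
have D s : U (p s) -> dom i (g (p s)) ->
    is_derive s 1 ((chart i \o g) \o p) ('D_1 p s *: 'D_1 (chart i \o g) (p s)).
  move=> Us si; have [_ /(_ i si)[d3 _]] := gU _ Us.
  exact: (is_derive_reparam d3 (dp s)).
split; first by have [] := D t Upt it.
apply: (@continuous_at_near_eq _ _ (fun s => 'D_1 p s *: 'D_1 (chart i \o g) (p s))).
  apply: continuousZ; first exact: cDp.
  by apply: (@continuous_comp _ _ _ p ('D_1 (chart i \o g))); [exact: cp|exact: d2].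
have n1 : \forall s \near t, U (p s).
  by apply: (cp t); exact: open_nbhs_nbhs.
have n2 : \forall s \near t, dom i (g (p s)).
  have cgp : {for t, continuous (g \o p)} by apply: continuous_comp; [exact: cp | exact: cg].
  by apply: cgp; apply: open_nbhs_nbhs; split => //; exact: dom_open.
by apply: filterS2 n1 n2 => s Us si; have [_ ->] := D s Us si.
Qed.

Lemma velocity_glue (a : R) g h : g a = h a -> C1_at g a -> C1_at h a ->
  (forall i, dom i (g a) -> 'D_1 (chart i \o g) a = 'D_1 (chart i \o h) a) ->
  velocity (glue a g h) = glue a (velocity g) (velocity h).
Proof.
move=> gh [cg dg] [ch dh] D; apply/funext => t.
have [ta|ta|->] := ltgtP t a.
- have e : glue a g h t = g t by rewrite /glue ltW.
  rewrite [RHS]/glue ltW// /velocity e !derive1E comp_glue.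
  by apply: near_eq_derive; exact: glue_near_lt.
- have e : glue a g h t = h t by rewrite /glue leNgt ta.
  rewrite [RHS]/glue leNgt ta/= /velocity e !derive1E comp_glue.
  by apply: near_eq_derive; exact: glue_near_gt.
have e : glue a g h a = g a by rewrite /glue lexx.
rewrite [RHS]/glue lexx /velocity e !derive1E comp_glue.
have ia := chart_at_dom (g a); have ib := ia; rewrite {2}gh in ib.
have [d1 _] := dg _ ia; have [e1 _] := dh _ ib.
have ghi : (chart (chart_at (g a)) \o g) a = (chart (chart_at (g a)) \o h) a.
  by rewrite /= gh.
have E := congr1 (fun f => f a) (derive_glue ghi d1 e1 (D _ ia)).
by apply: etrans E _; rewrite /glue lexx.
Qed.

Lemma velocity_comp g p t : C1_at g (p t) -> derivable p t 1 ->
  velocity (g \o p) t = 'D_1 p t *: velocity g (p t).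
Proof.
move=> [_ /(_ _ (chart_at_dom (g (p t))))[d1 _]] dp.
rewrite /velocity !derive1E.
by have [_ <-] := is_derive_reparam d1 dp.
Qed.

End manifold.
End reparametrize.

(** * Concatenation of curves *)

Section length.
Variables (R : realType) (n : nat) (M : finsler_manifold R n).
Implicit Types (g h : R -> M) (t k : R).
Local Notation mu := (@lebesgue_measure R).

Lemma within_continuous_speed (U : set R) g (a b : R) : open U ->
  `[a, b] `<=` U -> (forall t, U t -> C1_at g t) ->
  {within `[a, b], continuous (speed g)}.
Proof.
move=> oU abU gU; apply: continuous_in_subspaceT => t /set_mem /abU Ut.
apply: continuous_speed; have : nbhs t U by exact: open_nbhs_nbhs.
by apply: filterS.
Qed.

Lemma integrable_speed (U : set R) g (a b : R) : open U ->
  `[a, b] `<=` U -> (forall t, U t -> C1_at g t) ->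
  mu.-integrable `[a, b] (EFin \o speed g).
Proof.
move=> oU abU gU; apply: continuous_compact_integrable.
  exact: segment_compact.
exact: within_continuous_speed gU.
Qed.

Lemma curve_lengthE g : curve_length g = \int[mu]_(t in `[0, 1]) speed g t.
Proof. by []. Qed.

Lemma curve_length_ge0 g : 0 <= curve_length g.
Proof. by apply: Rintegral_ge0 => t _; exact: finsler_ge0. Qed.

Lemma speed_comp g (p : R -> R) t : C1_at g (p t) -> derivable p t 1 ->
  0 <= 'D_1 p t -> speed (g \o p) t = 'D_1 p t * speed g (p t).
Proof. by move=> Cg dp p0; rewrite /speed (velocity_comp Cg dp) finslerZ. Qed.

(** The substitution [s = ramp k t]: the derivative of the ramp is nonnegative, so positive
    homogeneity takes it out of the metric as the Jacobian factor. *)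
Lemma curve_length_ramp (U : set R) g k : open U ->
  `[0, 1] `<=` U -> (forall t, U t -> C1_at g t) ->
  \int[mu]_(t in `[k / 2, (k + 1) / 2]) speed (g \o ramp k) t = curve_length g.
Proof.
move=> oU U01 gU; rewrite curve_lengthE /Rintegral; apply: (congr1 fine).
have kk : k / 2 <= (k + 1) / 2 by lra.
have cd (x : R) : 'D_1 (ramp k) y @[y --> x] --> 'D_1 (ramp k) x by exact: continuous_derive_ramp.
have Dr : (ramp k)^`()%classic = 'D_1 (ramp k) by apply/funext => x; rewrite derive1E.
have cr (x : R) : ramp k y @[y --> x] --> ramp k x by exact: continuous_ramp.
have := @integration_by_substitution_increasing R (ramp k) (speed g) _ _ kk (@ramp_mono R k).
rewrite Dr ramp_start ramp_end => ->.
- apply: eq_integral => t /set_mem; rewrite /= in_itv/= => kt.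
  have Ut : U (ramp k t) by apply: U01; exact: ramp_itv.
  have E := speed_comp (gU _ Ut) (@derivable_ramp R k t) (derive_ramp_ge0 kt).
  by apply: (congr1 EFin); apply: etrans E _; rewrite mulrC.
- by move=> x _; exact: continuous_derive_ramp.
- by apply/cvg_ex; exists ('D_1 (ramp k) (k / 2)); exact: cvg_at_right_filter.
- by apply/cvg_ex; exists ('D_1 (ramp k) ((k + 1) / 2)); exact: cvg_at_left_filter.
- split; [by move=> x _; exact: derivable_ramp|exact: cvg_at_right_filter|exact: cvg_at_left_filter].
- exact: within_continuous_speed gU.
Qed.

(** [g] is run on the first half of the interval and [h] on the second. The ramps stop both at the
    midpoint [a], so the glued curve is C^1 there whatever the angle between [g] and [h]. *)
Lemma concat_curve g h : C1_curve g -> C1_curve h -> g 1 = h 0 ->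
  exists c : R -> M, [/\ C1_curve c, c 0 = g 0, c 1 = h 1 &
    curve_length c = curve_length g + curve_length h].
Proof.
move=> /C1_curveP[U [oU U01 gU]] /C1_curveP[V [oV V01 hV]] gh.
pose g' := g \o ramp 0; pose h' := h \o ramp 1; pose a : R := 2^-1.
have a0 : a = (0 + 1) / 2 by rewrite /a; lra.
have a1 : a = 1 / 2 by rewrite /a; lra.
have gh' : g' a = h' a.
  by rewrite /g' /h' /= {1}a0 {1}a1 ramp_end ramp_start.
pose A := ramp 0 @^-1` U; pose B := ramp 1 @^-1` V.
have oA : open A by apply: open_comp => // x _; exact: continuous_ramp.
have oB : open B by apply: open_comp => // x _; exact: continuous_ramp.
have Cg t : A t -> C1_at g' t.
  apply: (C1_at_comp oU gU); first exact: derivable_ramp.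
  exact: continuous_derive_ramp.
have Ch t : B t -> C1_at h' t.
  apply: (C1_at_comp oV hV); first exact: derivable_ramp.
  exact: continuous_derive_ramp.
have Ug1 : U 1 by apply: U01; rewrite /= in_itv/= ler01 lexx.
have Vh0 : V 0 by apply: V01; rewrite /= in_itv/= ler01 lexx.
have Aa : A a by rewrite /A /= a0 ramp_end.
have Ba : B a by rewrite /B /= a1 ramp_start.
have Dg i : dom i (g' a) -> 'D_1 (chart i \o g') a = 0.
  move=> ia; have [_ /(_ i)] := gU _ Aa; move=> /(_ ia)[d1 _].
  have [_ E] := is_derive_reparam d1 (@derivable_ramp R 0 a).
  by apply: etrans E _; rewrite derive_ramp a0 (_ : 1 - _ = 0) ?mulr0 ?scale0r//; lra.
have Dh i : dom i (h' a) -> 'D_1 (chart i \o h') a = 0.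
  move=> ia; have [_ /(_ i)] := hV _ Ba; move=> /(_ ia)[d1 _].
  have [_ E] := is_derive_reparam d1 (@derivable_ramp R 1 a).
  apply: etrans E _; rewrite derive_ramp a1 (_ : 2 * _ - _ = 0) ?mulr0 ?mul0r ?scale0r//; lra.
have Dgh i : dom i (g' a) -> 'D_1 (chart i \o g') a = 'D_1 (chart i \o h') a.
  by move=> ia; rewrite (Dg i ia) Dh -?gh'.
pose c := glue a g' h'.
(* An open set on which the glued curve is C^1: to the left of [a] only [g'] is constrained, to the
   right only [h'], and both near [a]. *)
pose W := (A `&` [set t | t < a]) `|` (B `&` [set t | a < t]) `|` (A `&` B).
have oW : open W.
  apply: openU; last exact: openI.
  by apply: openU; apply: openI.
have CW t : W t -> C1_at c t.
  have [ta|ta|->] := ltgtP t a.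
  - move=> Wt; apply: (@C1_at_near_eq _ _ _ g').
      by apply: filterS (glue_near_lt g' h' ta) => s; exact: esym.
    by apply: Cg; move: Wt => [[[]|[_ /= at']]|[]]//; move: (lt_trans ta at'); rewrite ltxx.
  - move=> Wt; apply: (@C1_at_near_eq _ _ _ h').
      by apply: filterS (glue_near_gt g' h' ta) => s; exact: esym.
    by apply: Ch; move: Wt => [[[_ /= at']|[]]|[]]//; move: (lt_trans ta at'); rewrite ltxx.
  - by move=> _; apply: C1_at_glue => //; [exact: Cg | exact: Ch].
have W01 : `[0, 1] `<=` W.
  move=> t; rewrite /= in_itv/= => /andP[t0 t1].
  have At : t <= a -> A t.
    by move=> ta; apply: U01; apply: ramp_itv; rewrite -a0 ta mul0r t0.
  have Bt : a <= t -> B t.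
    by move=> ta; apply: V01; apply: ramp_itv; rewrite -a1 ta/=; lra.
  have [ta|ta|ta] := ltgtP t a.
  - by left; left; split=> //; apply/At/ltW.
  - by left; right; split=> //; apply/Bt/ltW.
  - by right; split; [apply: At|apply: Bt]; rewrite ta.
exists c; split.
- by apply/C1_curveP; exists W.
- rewrite /c /glue ifT; last by rewrite /a; lra.
  by rewrite /g' /= -[X in ramp _ X](mul0r 2^-1) ramp_start.
- rewrite /c /glue ifF; last by apply/negbTE; rewrite -ltNge /a; lra.
  by rewrite /h' /= (_ : ramp 1 1 = 1)// -[RHS](ramp_end 1); congr ramp; lra.
have speedE : speed c = glue a (speed g') (speed h').
  have vE := velocity_glue gh' (Cg a Aa) (Ch a Ba) Dgh.
  by apply/funext => t; rewrite /speed /c vE /glue; case: ifP.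
have ic : mu.-integrable `[0, 1] (EFin \o speed c) by exact: integrable_speed W01 CW.
have ih : mu.-integrable `[a, 1] (EFin \o speed h').
  apply: (integrable_speed oB _ Ch) => t; rewrite /= in_itv/= => /andP[t0 t1].
  by apply: V01; apply: ramp_itv; rewrite -a1 t0/=; lra.
rewrite -(curve_length_ramp 0 oU U01 gU) -(curve_length_ramp 1 oV V01 hV).
rewrite mul0r -a0 -a1 (_ : (1 + 1) / 2 = 1); last by lra.
rewrite curve_lengthE.
have split_a : \int[mu]_(t in `[0, 1]) speed c t =
    \int[mu]_(t in `[0, a]) speed c t + \int[mu]_(t in `]a, 1]) speed c t.
  have B0a : (BLeft 0 <= BRight a)%O by rewrite bnd_simp /a; lra.
  have Ba1 : (BRight a <= BRight 1)%O by rewrite bnd_simp /a; lra.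
  rewrite -(Rintegral_itvB ic B0a Ba1).
  by set x := \int[mu]_(t in _) _; set y := \int[mu]_(t in _) _; rewrite addrC subrK.
rewrite split_a; apply: f_equal2.
  apply: eq_Rintegral => t /set_mem; rewrite /= in_itv/= => /andP[_ ta].
  by rewrite speedE /glue ta.
(* At [a] itself the glued speed is that of [g']; this endpoint is a null set. *)
have ih' : mu.-integrable `]a, 1] (EFin \o speed h').
  by apply: integrableS ih => //; apply: subset_itvr; rewrite bnd_simp.
rewrite -(Rintegral_itv_obnd_cbnd ih').
apply: eq_Rintegral => t /set_mem; rewrite /= in_itv/= => /andP[ta _].
by rewrite speedE /glue leNgt ta.
Qed.

End length.

(** * The Finsler distance *)

Section distance.
Variables (R : realType) (n : nat) (M : finsler_manifold R n).
Implicit Types (g : R -> M) (x y z : M) (t : R) (i j : chart_index M).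
Local Notation mu := (@lebesgue_measure R).

(** The curve is the straight segment in the chart. By convexity it stays in the ball of radius [e],
    where [in_chart_bound] bounds its speed by [B] times the norm of the constant derivative
    [w - v]. *)
Lemma segment_curve i (u0 : 'rV[R]_n) : (chart i @` dom i) u0 ->
  exists e B : R, [/\ 0 < e, 0 <= B &
    forall v w, `|v - u0| < e -> `|w - u0| < e ->
    exists g, [/\ C1_curve g, g 0 = chart_inv i v, g 1 = chart_inv i w &
      curve_length g <= B * `|w - v|]].
Proof.
move=> iu0; have [e [B [e0 B0 eB]]] := in_chart_bound iu0.
exists e, B; split=> // v w ve we.
pose l t := v + t *: (w - v); pose g t := chart_inv i (l t).
have cl : continuous l.
  move=> t; apply: (@cvgD _ _ _ _ _ (fun=> v) (fun t => t *: (w - v))).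
    exact: cvg_cst.
  by apply: cvgZ; [exact: cvg_id | exact: cvg_cst].
pose U := [set t | `|l t - u0| < e].
have oU : open U.
  rewrite (_ : U = l @^-1` ball u0 e).
    by apply: open_comp; [move=> t _; exact: cl | exact: ball_open].
  by apply/funext => t; rewrite /U -ball_normE /= distrC.
have U01 : `[0, 1] `<=` U.
  move=> t; rewrite /= in_itv/= => /andP[t0 t1]; rewrite /U /= /l.
  rewrite (_ : _ - u0 = (1 - t) *: (v - u0) + t *: (w - u0)); last first.
    rewrite scalerBl scale1r !scalerBr opprB.
    apply/rowP => k; rewrite !mxE; ring.
  apply: le_lt_trans (ler_normD _ _) _; rewrite !normrZ (ger0_norm t0) ger0_norm ?subr_ge0//.
  (* The strict inequality comes from the term in [t], which needs [t > 0]. *)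
  have [->|tn0] := eqVneq t 0; first by rewrite subr0 mul1r mul0r addr0.
  have tp : 0 < t by rewrite lt_neqAle eq_sym tn0.
  have : t * `|w - u0| < t * e by rewrite ltr_pM2l.
  have : (1 - t) * `|v - u0| <= (1 - t) * e.
    by apply: ler_wpM2l; [rewrite subr_ge0 | exact: ltW].
  lra.
have lD j s : U s -> dom j (g s) -> is_derive s 1 (chart j \o g)
    ('D_(w - v) (chart j \o chart_inv i) (l s)).
  move=> Us js; apply: (@is_derive_line _ _ _ (chart j \o chart_inv i)).
  have [[x ix xl] _] := eB _ Us.
  rewrite -/(l s) -xl; apply: diff_derivable; apply: transition_differentiable => //.
  by move: js; rewrite /g -xl chartK.
have cg t : U t -> {for t, continuous g}.
  move=> Ut; apply: continuous_comp; first exact: cl.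
  exact: (chart_inv_continuous (eB _ Ut).1).
have CU t : U t -> C1_at g t.
  move=> Ut; split; first exact: cg.
  move=> j jt; split; first by have [] := lD j t Ut jt.
  apply: (@continuous_at_near_eq _ _ ('D_(w - v) (chart j \o chart_inv i) \o l)).
    apply: continuous_comp; first exact: cl.
    have [_ /(_ (w - v))[_ [+ _]]] := @transition_C1 _ _ _ i j; apply.
    have [[x ix xl] _] := eB _ Ut; exists x => //; split => //.
    by move: jt; rewrite /g -xl chartK.
  have n1 : \forall s \near t, U s by exact: open_nbhs_nbhs.
  have n2 : \forall s \near t, dom j (g s).
    by apply: (cg t Ut); apply: open_nbhs_nbhs; split=> //; exact: dom_open.
  by apply: filterS2 n1 n2 => s Us js; have [_ E] := lD j s Us js; exact: esym.
exists g; split.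
- by apply/C1_curveP; exists U.
- by rewrite /g /l scale0r addr0.
- by rewrite /g /l scale1r addrC subrK.
have le t : `[0, 1]%classic t -> speed g t <= B * `|w - v|.
  move=> /U01 Ut; apply: le_trans ((eB _ Ut).2 (w - v)).
  have [_ E] := lD _ t Ut (chart_at_dom (g t)).
  suff -> : speed g t = in_chart (@finsler _ _ M) i (l t, w - v) by [].
  by rewrite /speed /velocity derive1E; apply: (congr1 (finsler (g t))).
rewrite curve_lengthE.
apply: (@le_trans _ _ (\int[mu]_(t in `[0, 1]) (cst (B * `|w - v|) t))).
  apply: le_Rintegral => //.
    exact: integrable_speed CU.
  apply: continuous_compact_integrable; first exact: segment_compact.
  by apply: continuous_subspaceT => t; exact: cvg_cst.
rewrite Rintegral_cst//= lebesgue_measure_itv/= lte_fin ltr01.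
by rewrite sube0 /= mulr1.
Qed.

Definition joined x y : Prop :=
  exists g, [/\ C1_curve g, g 0 = x & g 1 = y].

Lemma joined_trans x y z : joined x y -> joined y z -> joined x z.
Proof.
move=> [g [Cg g0 g1]] [h [Ch h0 h1]].
have [|c [Cc c0 c1 _]] := concat_curve Cg Ch; first by rewrite g1 h0.
by exists c; split=> //; [rewrite c0|rewrite c1].
Qed.

Lemma near_chart_close x (e : R) : 0 < e ->
  \forall z \near x, dom (chart_at x) z /\
    `|chart (chart_at x) z - chart (chart_at x) x| < e.
Proof.
move=> e0; apply: filterI.
  by apply: open_nbhs_nbhs; split; [exact: dom_open|exact: chart_at_dom].
have := chart_continuous (chart_at_dom x).
by move=> /cvgrPdist_lt /(_ e e0); apply: filterS => z; rewrite distrC.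
Qed.

(** Both directions are recorded because the metric need not be reversible. *)
Lemma short_curves x (r : R) : 0 < r -> \forall z \near x,
  (exists g, [/\ C1_curve g, g 0 = x, g 1 = z & curve_length g < r]) /\
  (exists g, [/\ C1_curve g, g 0 = z, g 1 = x & curve_length g < r]).
Proof.
move=> r0; set i := chart_at x; have ix : dom i x := chart_at_dom x.
have iu : (chart i @` dom i) (chart i x) by exists x.
have [e [B [e0 B0 eB]]] := segment_curve iu.
have B1 : 0 < B + 1 by rewrite ltr_pwDr.
(* [B] may vanish, hence the division by [B + 1]. *)
have d0 : 0 < Num.min e (r / (B + 1)) by rewrite lt_min e0 divr_gt0.
apply: filterS (near_chart_close x d0) => z [iz].
rewrite lt_min ltr_pdivlMr// -/i => /andP[ze zr].
have xx : `|chart i x - chart i x| < e by rewrite subrr normr0.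
have lt_r (L : R) : L <= B * `|chart i z - chart i x| -> L < r.
  move=> /le_lt_trans; apply; apply: le_lt_trans zr.
  by rewrite mulrC ler_wpM2l// lerDl.
split.
  have [g [Cg g0 g1 gL]] := eB _ _ xx ze.
  by exists g; split=> //; [rewrite g0 chartK|rewrite g1 chartK|exact: lt_r].
have [g [Cg g0 g1 gL]] := eB _ _ ze xx.
exists g; split=> //; [by rewrite g0 chartK|by rewrite g1 chartK|].
by apply: lt_r; rewrite distrC.
Qed.

(** The set of points reachable from [x] is open, since a point is joined to its neighbours, and
    closed, since the neighbours are joined back to it; connectedness concludes. Thus [dF] is never
    the infimum of an empty set. *)
Lemma all_joined x y : joined x y.
Proof.
have nj z : \forall w \near z, joined z w /\ joined w z.
  apply: filterS (short_curves z ltr01) => w [[g [Cg g0 g1 _]] [h [Ch h0 h1 _]]].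
  by split; [exists g | exists h].
suff : [set y | joined x y] = [set: M] by move=> E; have : [set: M] y by []; rewrite -E.
have oJ : open [set y | joined x y].
  rewrite openE => z xz; apply: filterS (nj z) => w [zw _].
  exact: joined_trans zw.
apply: manifold_connected.
- by exists x; have [] := nbhs_singleton (nj x).
- by exists [set y | joined x y] => //; rewrite setTI.
exists [set y | joined x y]; last by rewrite setTI.
rewrite -[X in closed X]setCK; apply: open_closedC.
rewrite openE => z xz; apply: filterS (nj z) => w [_ wz] xw.
by apply: xz; exact: joined_trans wz.
Qed.

Lemma dF_le g : C1_curve g -> dF (g 0) (g 1) <= curve_length g.
Proof.
move=> Cg; apply: ge_inf; last by exists g.
by exists 0 => _ [h _ <-]; exact: curve_length_ge0.
Qed.

Lemma dF_ge0 x y : 0 <= dF x y.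
Proof.
apply: lb_le_inf.
  by have [g [Cg g0 g1]] := all_joined x y; exists (curve_length g); exists g.
by move=> _ [g _ <-]; exact: curve_length_ge0.
Qed.

(** Any two competing curves concatenate to a competitor from [x] to [z]; the infima are then taken
    over one curve at a time. *)
Lemma dF_triangle x y z : dF x z <= dF x y + dF y z.
Proof.
have ne (a b : M) : [set curve_length g | g in [set g : R -> M | [/\ C1_curve g, g 0 = a & g 1 = b]]] !=set0.
  by have [g gab] := all_joined a b; exists (curve_length g); exists g.
rewrite -lerBlDr; apply: lb_le_inf => // _ [g [Cg g0 g1] <-].
rewrite lerBlDr addrC -lerBlDr; apply: lb_le_inf => // _ [h [Ch h0 h1] <-].
rewrite lerBlDr addrC.
have [|c [Cc c0 c1 <-]] := concat_curve Cg Ch; first by rewrite g1 h0.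
by rewrite -g0 -h1 -c0 -c1; exact: dF_le.
Qed.

Lemma near_dF x (r : R) : 0 < r -> \forall z \near x, dF x z < r /\ dF z x < r.
Proof.
move=> /(short_curves x); apply: filterS => z [[g [Cg g0 g1 gr]] [h [Ch h0 h1 hr]]].
split; first by rewrite -g0 -g1; exact: le_lt_trans (dF_le Cg) gr.
by rewrite -h0 -h1; exact: le_lt_trans (dF_le Ch) hr.
Qed.

(** The Lipschitz condition is one-sided, but [dF x z] and [dF z x] are both small for [z] near
    [x]. *)
Lemma lipschitz1_continuous (f : M -> R) : lipschitz1 f -> continuous f.
Proof.
move=> lf x; apply/cvgrPdist_lt => r r0.
apply: filterS (near_dF x r0) => z [xz zx].
rewrite ltr_norml; have := lf x z; have := lf z x; lra.
Qed.

End distance.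

(** * Tails, means and medians *)

Section tails.
Context d (T : measurableType d) (R : realType) (P : probability T R).
Implicit Types (f : T -> R) (K C c m r : R).

Let RV_of f (mf : measurable_fun [set: T] f) : {RV P >-> R} :=
  HB.pack f (isMeasurableFun.Build _ _ _ _ f mf).

Lemma measurable_ge_set f r : measurable_fun [set: T] f -> measurable [set x | r <= f x].
Proof.
move=> mf; have := mf measurableT `[r, +oo[%classic (measurable_itv _).
by rewrite setTI (_ : _ @^-1` _ = [set x | r <= f x])//;
  apply/funext => x /=; rewrite in_itv/= andbT.
Qed.

Lemma measurable_le_set f r : measurable_fun [set: T] f -> measurable [set x | f x <= r].
Proof.
move=> mf; have := mf measurableT `]-oo, r]%classic (measurable_itv _).
by rewrite setTI (_ : _ @^-1` _ = [set x | f x <= r])//;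
  apply/funext => x /=; rewrite in_itv/=.
Qed.

(** By the layer-cake formula the integral is that of the tail, which is at most [K / c] times the
    exponential density of rate [c]. *)
Lemma integral_le_tail f K c : measurable_fun [set: T] f -> (forall x, 0 <= f x) ->
  1 <= K -> 0 < c ->
  (forall r, 0 < r -> (P [set x | (r <= f x)%R] <= (K * expR (- c * r))%:E)%E) ->
  (\int[P]_x (f x)%:E <= (K / c)%:E)%E.
Proof.
move=> mf f0 K1 c0 tail.
have K0 : 0 <= K by apply: le_trans K1.
have := ge0_expectation_ccdf (X := RV_of mf) f0.
rewrite unlock => ->.
have mexp : measurable_fun [set: R] (fun r : R => (exponential_pdf c r)%:E : \bar R).
  by apply/measurable_EFinP; exact: measurable_exponential_pdf.
have pdf0 x : (0 <= (exponential_pdf c x)%:E)%E.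
  by rewrite lee_fin exponential_pdf_ge0// ltW.
apply: (@le_trans _ _ (\int[lebesgue_measure]_(r in `[0%R, +oo[)
    ((K / c)%:E * (exponential_pdf c r)%:E))%E).
  apply: ge0_le_integral => //.
  - by apply: measurable_funTS; exact: ccdf_measurable.
  - apply: measurable_funTS; apply: emeasurable_funM => //.
  - move=> r; rewrite /= in_itv/= andbT => r0.
    rewrite exponential_pdfE// -EFinM mulrA divfK ?gt_eqF//.
    (* At [r = 0], where no tail bound is assumed, a probability is at most [1 <= K]. *)
    move: r0; rewrite le_eqVlt => /predU1P[<-|r0].
      rewrite mulr0 expR0 mulr1; apply: le_trans (probability_le1 _ _) _ => //.
    apply: le_trans (tail r r0); apply: (@le_measure _ _ _ P); rewrite ?inE.
    + by apply: measurable_funPTI.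
    + exact: measurable_ge_set.
    + by move=> x /=; rewrite in_itv/= andbT => /ltW.
rewrite ge0_integralZl//; last 2 first.
  by apply: measurable_funTS.
  by rewrite lee_fin divr_ge0// ltW.
rewrite -[leRHS]mule1; apply: lee_wpmul2l; first by rewrite lee_fin divr_ge0// ltW.
rewrite -(integral_exponential_pdf c0).
by apply: ge0_subset_integral.
Qed.

(** The difference between the mean and [m] is at most the integral of the distance from [f] to [m],
    which [integral_le_tail] bounds. *)
Lemma mean_close f m K c : measurable_fun [set: T] f -> 1 <= K -> 0 < c ->
  (forall r, 0 < r -> (P [set x | (r <= `|f x - m|)%R] <= (K * expR (- c * r))%:E)%E) ->
  P.-integrable [set: T] (EFin \o f) /\ `|\int[P]_x f x - m| <= K / c.
Proof.
move=> mf K1 c0 tail.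
have mfm : measurable_fun [set: T] (fun x => f x - m).
  by apply: measurable_funB => //; exact: measurable_cst.
have mnfm : measurable_fun [set: T] (fun x => `|f x - m|).
  by apply: measurableT_comp.
have le_Kc := integral_le_tail mnfm (fun x => normr_ge0 _) K1 c0 tail.
have ifm : P.-integrable [set: T] (EFin \o (fun x => f x - m)).
  apply/integrableP; split; first exact/measurable_EFinP.
  by apply: le_lt_trans le_Kc _; rewrite ltry.
have im : P.-integrable [set: T] (EFin \o (fun=> m)).
  exact: finite_measure_integrable_cst.
have if_ : P.-integrable [set: T] (EFin \o f).
  have := integrableD measurableT ifm im; apply: eq_integrable => // x _.
  by rewrite /= -EFinD subrK.
split=> //.
have -> : \int[P]_x f x - m = \int[P]_x (f x - m).
  by rewrite RintegralB// Rintegral_cst// [X in fine X]probability_setT mulr1.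
apply: le_trans (le_normr_Rintegral measurableT ifm) _.
by rewrite -lee_fin fineK //; rewrite ge0_fin_numE ?integral_ge0//;
  exact: le_lt_trans le_Kc (ltry _).
Qed.

(** Passing from [m] to the mean shifts [r] by at most [K / c], which costs the factor [expR K]. For
    [r <= K / c] the claimed bound is at least 1. *)
Lemma deviation_from_mean f m K c : measurable_fun [set: T] f -> 1 <= K -> 0 < c ->
  (forall r, 0 < r -> (P [set x | (r <= `|f x - m|)%R] <= (K * expR (- c * r))%:E)%E) ->
  forall r, 0 < r ->
  (P [set x | (r <= `|f x - \int[P]_y f y|)%R] <= (K * expR K * expR (- c * r))%:E)%E.
Proof.
move=> mf K1 c0 tail r r0; have [_] := mean_close mf K1 c0 tail.
set E := \int[P]_x f x => EK.
have K0 : 0 <= K by apply: le_trans K1.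
have mset b s : measurable [set x | s <= `|f x - b|].
  apply: measurable_ge_set; apply: measurableT_comp => //.
  by apply: measurable_funB => //; exact: measurable_cst.
rewrite -mulrA -expRD.
have [rK|rK] := leP r (K / c).
  apply: le_trans (probability_le1 _ (mset _ _)) _; rewrite lee_fin.
  rewrite -[X in X <= _]mulr1; apply: ler_pM => //.
  by rewrite -[X in X <= _]expR0 ler_expR; move: rK; rewrite ler_pdivlMr//; lra.
have -> : K + - c * r = - c * (r - K / c) by field; rewrite gt_eqF.
apply: le_trans (tail _ _); last by rewrite subr_gt0.
apply: le_measure; rewrite ?inE//; try exact: mset.
move=> x /= rx; have := ler_distD m (f x) E; rewrite (distrC m) => H.
by rewrite lerBlDr; apply: le_trans rx (le_trans H _); rewrite lerD2l.
Qed.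

(* The slack [e] spares the continuity properties of an exact median. *)
Lemma quasi_median f (e : R) : measurable_fun [set: T] f -> 0 < e ->
  exists m, ((2^-1 : R)%:E <= P [set x | (f x <= m + e)%R])%E /\
            ((2^-1 : R)%:E <= P [set x | (m - e <= f x)%R])%E.
Proof.
move=> mf e0; pose X := RV_of mf.
have cdfE r : cdf X r = P [set x | f x <= r].
  by congr (P _); apply/funext => x; rewrite /= in_itv.
(* [m] will be the infimum of [S], which is nonempty because the distribution function tends to 1 at
   infinity and bounded below because it tends to 0 at minus infinity. *)
pose S := [set t : R | ((2^-1 : R)%:E <= P [set x | (f x <= t)%R])%E].
have S0 : S !=set0.
  have H : \forall t \near +oo_R, (((2^-1 : R)%:E) < cdf X t)%E.
    have h : ((2^-1 : R)%:E < 1)%E by rewrite lte_fin invf_lt1 ?ltr1n.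
    have N : nbhs (1 : \bar R)%E [set y | ((2^-1 : R)%:E < y)%E].
      by apply: open_nbhs_nbhs; split => //; exact: open_ereal_gt_ereal.
    exact: (cvg_cdfy1 X N).
  have [t Ht] := filter_ex H; exists t; rewrite /S /= -cdfE; exact: ltW.
have Slb : has_lbound S.
  have H : \forall t \near -oo_R, (cdf X t < ((2^-1 : R)%:E))%E.
    have h : (0 < (2^-1 : R)%:E)%E by rewrite lte_fin invr_gt0.
    have N : nbhs (0 : \bar R)%E [set y | (y < (2^-1 : R)%:E)%E].
      by apply: open_nbhs_nbhs; split => //; exact: open_ereal_lt_ereal.
    exact: (cvg_cdfNy0 X N).
  have [t Ht] := filter_ex H; exists t => s; rewrite /S /= -cdfE => Hs.
  rewrite leNgt; apply/negP => st.
  have := le_trans Hs (cdf_nondecreasing X (ltW st)).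
  by rewrite leNgt Ht.
pose m := inf S; exists m; split.
  have [s Ss sm] := @inf_adherent R S e e0 (conj S0 Slb).
  apply: le_trans Ss _; apply: le_measure; rewrite ?inE; try exact: measurable_le_set.
  by move=> x /= fs; apply: le_trans fs (ltW sm).
(* Otherwise the two sets cut at the level [m - e], which is below the infimum of [S], would both
   have measure less than 1/2, yet they cover the space. *)
rewrite leNgt; apply/negP => lt.
have : (P [set x | (f x <= m - e)%R] < (2^-1 : R)%:E)%E.
  rewrite ltNge; apply/negP => Sme.
  have : m <= m - e by exact: ge_inf.
  lra.
move=> lt2; have := lteD lt lt2.
rewrite -EFinD (_ : 2^-1 + 2^-1 = 1 :> R); last by lra.
apply/negP; rewrite -leNgt.
have U2 := measureU2 P (measurable_ge_set (m - e) mf) (measurable_le_set (m - e) mf).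
apply: le_trans U2; rewrite -[X in (X <= _)%E](probability_setT P).
rewrite (_ : _ `|` _ = setT); first exact: lexx.
apply/seteqP; split => // x _ /=; have [|/ltW] := leP (f x) (m - e); by [right|left].
Qed.

(** A quasi-median with slack [1 / c] serves as [m]. The slack costs the factor [expR 1], the two
    one-sided tails give [2 * C], and the added 1 makes the bound trivial for [r <= 1 / c]. *)
Lemma deviation_from_median f C c : measurable_fun [set: T] f -> 0 < C -> 0 < c ->
  (forall a r, 0 < r -> ((2^-1 : R)%:E <= P [set x | (f x <= a)%R])%E ->
     (P [set x | (a + r <= f x)%R] <= (C * expR (- c * r))%:E)%E) ->
  (forall a r, 0 < r -> ((2^-1 : R)%:E <= P [set x | (a <= f x)%R])%E ->
     (P [set x | (f x <= a - r)%R] <= (C * expR (- c * r))%:E)%E) ->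
  exists m, forall r, 0 < r ->
    (P [set x | (r <= `|f x - m|)%R] <= ((expR 1 * (2 * C + 1)) * expR (- c * r))%:E)%E.
Proof.
move=> mf C0 c0 up dn.
have [m [m1 m2]] := quasi_median mf (@divr_gt0 R 1 c ltr01 c0).
exists m => r r0.
have mset b s : measurable [set x | s <= `|f x - b|].
  apply: measurable_ge_set; apply: measurableT_comp => //.
  by apply: measurable_funB => //; exact: measurable_cst.
have e0 := expR_gt0 (1 - c * r).
rewrite mulrAC mulNr -expRD.
have [rc|rc] := leP r (1 / c).
  apply: le_trans (probability_le1 _ (mset _ _)) _; rewrite lee_fin.
  have : 1 <= expR (1 - c * r).
    by rewrite -[X in X <= _]expR0 ler_expR; move: rc; rewrite ler_pdivlMr//; lra.
  have := mulr_gt0 C0 e0; lra.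
have rc0 : 0 < r - 1 / c by rewrite subr_gt0.
have Ee : - c * (r - 1 / c) = 1 - c * r by field; rewrite gt_eqF.
have := up _ _ rc0 m1; have := dn _ _ rc0 m2; rewrite Ee.
set A := [set x | _ <= m - _ - _]; set B := [set x | _ <= f x] => PA PB.
apply: (@le_trans _ _ (P (A `|` B))).
  apply: le_measure; rewrite ?inE.
  - exact: mset.
  - by apply: measurableU; [exact: measurable_le_set|exact: measurable_ge_set].
  - move=> x /=; rewrite ler_normr => /orP[rx|rx]; [right|left]; rewrite /A /B /=; lra.
have U2 := measureU2 P (measurable_le_set (m - 1 / c - (r - 1 / c)) mf) (measurable_ge_set (m + 1 / c + (r - 1 / c)) mf).
apply: le_trans U2 _.
apply: le_trans (leeD PA PB) _; rewrite -EFinD lee_fin; lra.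
Qed.

End tails.

(** * One-sided tails, and measures of mass one as probabilities *)

Section one_sided_tail.
Context d (T : measurableType d) (R : realType) (P : probability T R).

(* [E] is arbitrary so that the lemma also applies to the opposite of a
   Lipschitz function; the bound at [A] gives [exp(k E) <= 2 K]. *)
Lemma tail_from_deviation (f : T -> R) (A : set T) (E K k : R) :
  measurable_fun [set: T] f -> measurable A -> 0 < K -> 0 < k ->
  ((2^-1 : R)%:E <= P A)%E -> (forall x, A x -> f x <= 0) ->
  (forall s, 0 < s ->
    (P [set x | (s <= `|f x - E|)%R] <= (K * expR (- k * s))%:E)%E) ->
  forall r, 0 < r ->
    (P [set x | (r <= f x)%R] <= ((2 * K + 2 * K ^+ 2) * expR (- k * r))%:E)%E.
Proof.
move=> mf mA K0 k0 PA fA dev r r0.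
have mset s : measurable [set x | s <= `|f x - E|].
  apply: measurable_ge_set; apply: measurableT_comp => //.
  by apply: measurable_funB => //; exact: measurable_cst.
have mr := measurable_ge_set r mf.
have e0 := expR_gt0 (- k * r).
have Ke : 0 < K * expR (- k * r) by rewrite mulr_gt0.
have KKe : 0 < K ^+ 2 * expR (- k * r) by rewrite mulr_gt0 ?exprn_gt0.
have [E0|E0] := leP E 0.
  apply: le_trans (le_trans (dev r r0) _); last by rewrite lee_fin; lra.
  apply: le_measure; rewrite ?inE//.
  by move=> x /= rf; apply: le_trans (ler_norm _); lra.
(* On [A] the function is nonpositive, so it deviates from [E] by at least [E] on a set of measure
   at least 1/2. *)
have PE : 2^-1 <= K * expR (- k * E).
  rewrite -lee_fin; apply: le_trans PA (le_trans _ (dev E E0)).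
  apply: le_measure; rewrite ?inE//.
  by move=> x /= /fA fx; rewrite distrC; apply: le_trans (ler_norm _); lra.
(* For [r <= E] the previous inequality gives [1 <= 2 * K * expR (- k * r)], the first term of the
   constant. Beyond [E], the deviation [r - E] brings a factor [expR (k * E) <= 2 * K], hence the
   term [2 * K ^+ 2]. *)
have [rE|rE] := leP r E.
  apply: le_trans (probability_le1 _ mr) _; rewrite lee_fin.
  have : K * expR (- k * E) <= K * expR (- k * r).
    by rewrite ler_pM2l// ler_expR !mulNr lerN2 ler_pM2l.
  lra.
have rE0 : 0 < r - E by rewrite subr_gt0.
apply: le_trans (le_trans _ (dev _ rE0)) _.
  apply: le_measure; rewrite ?inE//.
  by move=> x /= rf; apply: le_trans (ler_norm _); lra.
rewrite lee_fin (_ : - k * (r - E) = - k * r + k * E); last by ring.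
rewrite expRD.
have kE : expR (k * E) <= 2 * K.
  have eE := expR_gt0 (k * E).
  have : 2^-1 * expR (k * E) <= K * expR (- k * E) * expR (k * E).
    by rewrite ler_wpM2r// ltW.
  by rewrite -mulrA -expRD mulNr addNr expR0; lra.
have : K * expR (- k * r) * expR (k * E) <= K * expR (- k * r) * (2 * K).
  by rewrite ler_pM2l.
rewrite -mulrA; move: KKe Ke; rewrite expr2; set z := expR (- k * r); lra.
Qed.

(** An alias of [mu] that carries the proof of total mass one, so that the probability structure can
    be attached to it. *)
Definition unit_measure (mu : {measure set T -> \bar R})
  (mu1 : mu [set: T] = 1%E) : set T -> \bar R := mu.

HB.instance Definition _ (mu : {measure set T -> \bar R}) (mu1 : mu [set: T] = 1%E) :=
  isMeasure.Build _ _ _ (unit_measure mu1) (measure0 mu) (measure_ge0 mu)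
    (@measure_semi_sigma_additive _ _ _ mu).

HB.instance Definition _ (mu : {measure set T -> \bar R}) (mu1 : mu [set: T] = 1%E) :=
  Measure_isProbability.Build _ _ _ (unit_measure mu1) mu1.

End one_sided_tail.

(** * Concentration and deviation *)

Section concentration.
Variables (R : realType) (n : nat) (M : finsler_mm_manifold R n).
Hypothesis vol1 : vol M [set: borel M] = 1%E.
Implicit Types (A : set M) (r : R) (f : M -> R).

Let P : probability (borel M) R := unit_measure vol1.

Lemma lipschitz1_measurable f : lipschitz1 f ->
  measurable_fun [set: borel M] (f : borel M -> R).
Proof.
move=> /lipschitz1_continuous cf.
apply: (measurability _ (RGenOInfty.measurableE R)) => _ [_ [x ->] <-].
rewrite setTI; apply: sub_sigma_algebra.
by apply: open_comp => [y _|]; [exact: cf | exact: interval_open].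
Qed.

Lemma fwd_ballP A r x : fwd_ball A r x <-> exists2 z, A z & dF z x < r.
Proof.
split=> [/ereal_inf_lt[_ [z Az <-]]|[z Az zx]]; first by rewrite lte_fin; exists z.
by apply: le_lt_trans (ereal_inf_lbound _) _; [exists z => //; reflexivity | rewrite lte_fin].
Qed.

Lemma bwd_ballP A r x : bwd_ball A r x <-> exists2 z, A z & dF x z < r.
Proof.
split=> [/ereal_inf_lt[_ [z Az <-]]|[z Az zx]]; first by rewrite lte_fin; exists z.
by apply: le_lt_trans (ereal_inf_lbound _) _; [exists z => //; reflexivity | rewrite lte_fin].
Qed.

(** The ball is open whatever [A] is: by the triangle inequality, [x] may move by the margin
    [r - dF z x]. *)
Lemma fwd_ball_measurable A r : measurable (fwd_ball A r : set (borel M)).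
Proof.
apply: sub_sigma_algebra; rewrite openE => x /fwd_ballP[z Az zx].
have d0 : 0 < r - dF z x by rewrite subr_gt0.
apply: filterS (near_dF x d0) => y [xy _]; apply/fwd_ballP; exists z => //.
by apply: le_lt_trans (dF_triangle z x y) _; lra.
Qed.

Lemma bwd_ball_measurable A r : measurable (bwd_ball A r : set (borel M)).
Proof.
apply: sub_sigma_algebra; rewrite openE => x /bwd_ballP[z Az zx].
have d0 : 0 < r - dF x z by rewrite subr_gt0.
apply: filterS (near_dF x d0) => y [_ yx]; apply/bwd_ballP; exists z => //.
by apply: le_lt_trans (dF_triangle y x z) _; lra.
Qed.

(** A property of points near [x] holds at [x] itself, so [near_dF] gives the value without a
    constant curve. *)
Lemma dFxx (x : M) : dF x x = 0.
Proof.
apply/eqP; rewrite eq_le dF_ge0 andbT; apply/ler_addgt0Pr => e e0; rewrite add0r.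
by have [/ltW] := nbhs_singleton (near_dF x e0).
Qed.

(** One minus the smaller ball measure dominates the measures of both complements. *)
Lemma concentration_balls (C c : R) A r : exp_concentration M C c -> 0 < r ->
  measurable (A : set (borel M)) -> ((2^-1 : R)%:E <= P A)%E ->
  (P (~` fwd_ball A r) <= (C * expR (- c * r))%:E)%E /\
  (P (~` bwd_ball A r) <= (C * expR (- c * r))%:E)%E.
Proof.
move=> conc r0 mA PA; have := conc r r0.
have : (1 - mine (P (fwd_ball A r)) (P (bwd_ball A r)) <= concentration_fun M r)%E.
  by apply: ereal_sup_ubound; exists A.
move=> /le_trans /[apply] H.
rewrite (probability_setC P (fwd_ball_measurable A r)).
rewrite (probability_setC P (bwd_ball_measurable A r)).
by split; apply: le_trans H; apply: leeB => //; rewrite ge_min lexx ?orbT.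
Qed.

Lemma concentration_deviation (C c : R) : 0 < C -> 0 < c ->
  exp_concentration M C c ->
  let K := expR 1 * (2 * C + 1) in exp_deviation M (K * expR K) c.
Proof.
move=> C0 c0 conc K f lf; have mf := lipschitz1_measurable lf.
(* [expR 1] is at least 2, and the term in [C] is positive. *)
have K1 : 1 <= K.
  have := expR_ge1Dx (1 : R); have := mulr_gt0 (expR_gt0 (1 : R)) C0.
  rewrite /K; lra.
have [m tail] : exists m, forall r, 0 < r ->
    (P [set x | (r <= `|f x - m|)%R] <= (K * expR (- c * r))%:E)%E.
  apply: deviation_from_median => // a r r0 half.
    have [+ _] := concentration_balls conc r0 (measurable_le_set a mf) half.
    apply: le_trans; apply: le_measure; rewrite ?inE.
    + exact: measurable_ge_set.
    + exact: (measurableC (fwd_ball_measurable _ _)).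
    + move=> x /= arf /fwd_ballP[z /= fa zx]; have := lf z x; lra.
  have [_ +] := concentration_balls conc r0 (measurable_ge_set a mf) half.
  apply: le_trans; apply: le_measure; rewrite ?inE.
  + exact: measurable_le_set.
  + exact: (measurableC (bwd_ball_measurable _ _)).
  + move=> x /= arf /bwd_ballP[z /= fa xz]; have := lf x z; lra.
have [if_ _] := mean_close mf K1 c0 tail.
by split; [exact: if_ | exact: deviation_from_mean mf K1 c0 tail].
Qed.

Lemma deviation_concentration (K k : R) : 0 < K -> 0 < k ->
  exp_deviation M K k -> exp_concentration M (2 * K + 2 * K ^+ 2) k.
Proof.
move=> K0 k0 dev r r0; apply: ge_ereal_sup => _ [A [mA PA] <-].
(* The real infima [F] and [B] below are meaningful only for nonempty [A], which its measure
   guarantees. *)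
have [a Aa] : A !=set0.
  apply/set0P/eqP => A0; move: PA; rewrite A0 measure0 lee_fin leNgt.
  by rewrite invr_gt0 ltr0n.
have lbF x : has_lbound [set dF z x | z in A].
  by exists 0 => _ [z _ <-]; exact: dF_ge0.
have lbB x : has_lbound [set dF x z | z in A].
  by exists 0 => _ [z _ <-]; exact: dF_ge0.
pose F (x : M) := inf [set dF z x | z in A].
pose B (x : M) := inf [set dF x z | z in A].
have lF : lipschitz1 F.
  move=> x y; suff : F y - dF x y <= F x by lra.
  apply: lb_le_inf; first by exists (dF a x); exists a.
  move=> _ [z Az <-]; have := dF_triangle z x y.
  have : F y <= dF z y by apply: ge_inf => //; exists z.
  lra.
(* The triangle inequality gives [B x - B y <= dF x y], so the asymmetric Lipschitz condition holds
   for the opposite of [B]. *)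
have lB : lipschitz1 (fun x => - B x).
  move=> x y; suff : B x - dF x y <= B y by lra.
  apply: lb_le_inf; first by exists (dF y a); exists a.
  move=> _ [z Az <-]; have := dF_triangle x y z.
  have : B x <= dF x z by apply: ge_inf => //; exists z.
  lra.
have FA x : A x -> F x <= 0.
  by move=> Ax; rewrite -(dFxx x); apply: ge_inf => //; exists x.
have BA x : A x -> B x <= 0.
  by move=> Ax; rewrite -(dFxx x); apply: ge_inf => //; exists x.
have mF := lipschitz1_measurable lF.
have mB : measurable_fun [set: borel M] (B : borel M -> R).
  have := measurable_funN (lipschitz1_measurable lB).
  by apply: eq_measurable_fun => x _ /=; rewrite opprK.
have [_ devF] := dev F lF; have [_ devB] := dev _ lB.
have tF := tail_from_deviation (P := P) mF mA K0 k0 PA FA devF r0.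
have tB : (P [set x | (r <= B x)%R] <=
    ((2 * K + 2 * K ^+ 2) * expR (- k * r))%:E)%E.
  (* The centre is minus the mean of [- B], so that [B] deviates from it exactly as [- B] does from
     its mean. *)
  apply: (@tail_from_deviation _ _ _ P B A (- \int[vol M]_y (- B y)) K k) => // s s0.
  rewrite (_ : mkset _ = [set x | s <= `|- B x - \int[vol M]_y (- B y)|]).
    exact: devB.
  by apply/funext => x /=; rewrite -opprD normrN opprK.
have cF : (1 - P (fwd_ball A r) <= ((2 * K + 2 * K ^+ 2) * expR (- k * r))%:E)%E.
  apply: le_trans tF; rewrite -(probability_setC P (fwd_ball_measurable A r)).
  apply: le_measure; rewrite ?inE.
  - exact: (measurableC (fwd_ball_measurable _ _)).
  - exact: measurable_ge_set.
  (* Outside the open ball every point of [A] is at distance at least [r], hence so is the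
     infimum. *)
  - move=> x nx; apply: lb_le_inf; first by exists (dF a x); exists a.
    move=> _ [z Az <-]; rewrite leNgt; apply/negP => zx.
    by apply: nx; apply/fwd_ballP; exists z.
have cB : (1 - P (bwd_ball A r) <= ((2 * K + 2 * K ^+ 2) * expR (- k * r))%:E)%E.
  apply: le_trans tB; rewrite -(probability_setC P (bwd_ball_measurable A r)).
  apply: le_measure; rewrite ?inE.
  - exact: (measurableC (bwd_ball_measurable _ _)).
  - exact: measurable_ge_set.
  - move=> x nx; apply: lb_le_inf; first by exists (dF x a); exists a.
    move=> _ [z Az <-]; rewrite leNgt; apply/negP => zx.
    by apply: nx; apply/bwd_ballP; exists z.
by rewrite /mine; case: ifP => _; [exact: cF | exact: cB].
Qed.

End concentration.

Unset Implicit Arguments.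

Theorem theorem3p13 (R : realType) :
  exists C' c' : R -> R,
    [/\ (forall C, 0 < C -> 0 < C' C),
        (forall c, 0 < c -> 0 < c' c) &
        forall (n : nat) (M : finsler_mm_manifold R n),
          vol M [set: borel M] = 1%E ->
          ((exists C c : R, [/\ 0 < C, 0 < c & exp_concentration M C c]) <->
           (exists K k : R, [/\ 0 < K, 0 < k & exp_deviation M K k])) /\
          (forall C c : R, 0 < C -> 0 < c -> exp_concentration M C c ->
             exp_deviation M (C' C) (c' c))].
Proof.
(* [K C] is the tail constant around a quasi-median, and [expR (K C)] the price of moving to the
   mean. *)
pose K (C : R) := expR 1 * (2 * C + 1); pose C' C := K C * expR (K C).
have C'0 C : 0 < C -> 0 < C' C.
  by move=> C0; rewrite /C' /K !mulr_gt0 ?expR_gt0//; lra.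
(* The exponential rate is preserved, so [c'] is the identity. *)
exists C', id; split=> // n M vol1.
have dir C c : 0 < C -> 0 < c -> exp_concentration M C c -> exp_deviation M (C' C) c.
  by move=> C0 c0; exact: concentration_deviation.
split=> //; split=> [[C [c [C0 c0 conc]]]|[K0 [k [K00 k0 dev]]]].
  by exists (C' C), c; split=> //; [exact: C'0 | exact: dir].
exists (2 * K0 + 2 * K0 ^+ 2), k; split=> //; last exact: deviation_concentration.
by rewrite addr_gt0// mulr_gt0// exprn_gt0.
Qed.
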